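(* Let $\Pi'=\Pi_1'\sqcup\Pi_2'$ be the simple roots of $\Delta'$, $\gamma=\tau_2\tau_1$ the Coxeter element and $d_1,\dots,d_{2s}$ the singular directions, chosen as described in the context (so that $\gamma=\mathrm{Ad}\,P_0|_{\mathfrak h'}$ and $\Delta'_+=\mathcal R(d_1)\sqcup\cdots\sqcup\mathcal R(d_s)$). Then $$\mathcal R(d_1)=\Pi_2',\qquad \mathcal R(d_2)=\gamma(-\Pi_1'),\qquad \mathcal R(d_{s-1})=\gamma^{-1}(-\Pi_2'),\qquad \mathcal R(d_s)=\Pi_1'.$$
   Context: Let $G$ be a complex simple Lie group of rank $l>1$ with Lie algebra $\mathfrak g$, Cartan subalgebra $\mathfrak h$, simple roots $\alpha_1,\dots,\alpha_l$, highest root $\psi=\sum_{i=1}^l q_i\alpha_i$, $\alpha_0=-\psi$, Coxeter number $s=1+\sum_{i=1}^l q_i$, and nonzero root vectors $e_\alpha\in\mathfrak g_\alpha$. Let $\epsilon_1,\dots,\epsilon_l\in\mathfrak h$ satisfy $\alpha_i(\epsilon_j)=\delta_{ij}$, $x_0=\sum_{i=1}^l\epsilon_i$, and $P_0=\exp(2\pi\sqrt{-1}\,x_0/s)\in G$. Let $E_+=\sum_{i=0}^l c_i^+e_{\alpha_i}$ with all $c_i^+\in\mathbb C^*$; it is regular semisimple (Kostant). Let $\mathfrak h'$ be the Cartan subalgebra of $\mathfrak g$ centralizing $E_+$, $\Delta'$ the roots with respect to $\mathfrak h'$, $W'$ their Weyl group. $\mathrm{Ad}\,P_0$ preserves $\mathfrak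 h'$ and $\delta=\mathrm{Ad}\,P_0|_{\mathfrak h'}\in W'$ is a Coxeter element; it acts on $\Delta'$ by $\delta(\beta)=\beta\circ\mathrm{Ad}(P_0)^{-1}$. Singular directions: the rays in $\mathbb C$ from $0$ through the points $\beta(-E_+)$, $\beta\in\Delta'$. There are $2s$ of them, equally spaced, labelled $d_1,\dots,d_{2s}$ clockwise. $\mathcal R(d_i)$ is the set of $\beta\in\Delta'$ such that $\beta(-E_+)$ lies on $d_i$. Bipartite Coxeter elements: any set of simple roots $\Pi'$ of $\Delta'$ has a partition $\Pi'=\Pi_1'\sqcup\Pi_2'$, unique up to the labelling of the two parts, such that the roots in each part are mutually orthogonal. Put $\tau_k=\prod_{\beta\in\Pi'_k}R_\beta$ ($k=1,2$), where $R_\beta$ is the reflection in $\beta$, and $\gamma=\tau_2\tau_1$. Choose $\Pi'$ and the labelling of the partition so that $\gamma=\delta$, and the initial direction $d_1$ so that the positive system $\Delta'_+$ with simple roots $\Pi'$ is $\Delta'_+=\mathcal R(d_1)\sqcup\cdots\sqcup\mathcal R(d_s)$ (such choices are possible). *)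

(* Defs.v *)
From mathcomp Require Export all_boot all_order all_algebra.
From mathcomp Require Export complex.
From mathcomp Require Export all_classical all_reals all_analysis.
Export numFieldNormedType.Exports.

Set Implicit Arguments.
Unset Strict Implicit.
Unset Printing Implicit Defensive.

Import Order.TTheory GRing.Theory Num.Theory.
Local Open Scope classical_set_scope.
Local Open Scope complex_scope.
Local Open Scope ring_scope.

Record lieBracket (K : fieldType) (g : vectType K) := LieBracket {
  lie_fun :> g -> g -> g;
  lie_linearl : forall y, linear (lie_fun^~ y);
  lie_linearr : forall x, linear (lie_fun x);
  lie_alt : forall x, lie_fun x x = 0;
  lie_jacobi : forall x y z,
    lie_fun x (lie_fun y z) + lie_fun y (lie_fun z x)
      + lie_fun z (lie_fun x y) = 0 }.

Section LieAlgebra.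
Variables (K : fieldType) (g : vectType K) (b : lieBracket g).

Definition ad (x : g) : 'End(g) := linfun (b x).

Definition lie_ideal (I : {vspace g}) : Prop :=
  forall x y, y \in I -> b x y \in I.

Definition lie_simple : Prop :=
  (exists x y, b x y != 0) /\
  (forall I : {vspace g}, lie_ideal I -> I = 0%VS \/ I = fullv).

Definition diagonalizable_end (f : 'End(g)) : Prop :=
  exists X : seq g,
    basis_of fullv X /\ (forall v, v \in X -> exists a : K, f v = a *: v).

Definition lie_commutes (U V : {vspace g}) : Prop :=
  forall x y, x \in U -> y \in V -> b x y = 0.

(* The usual definition for g semisimple over the complex numbers: a maximal abelian subalgebra all of whose elements are ad-semisimple. *)
Definition cartan_subalgebra (H : {vspace g}) : Prop :=
  [/\ lie_commutes H H,
      (forall A : {vspace g}, lie_commutes A A -> (H <= A)%VS -> A = H) &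
      (forall x, x \in H -> diagonalizable_end (ad x))].

Definition centralizer (x : g) : {vspace g} := lker (ad x).

Definition killing (x y : g) : K :=
  let e := vbasis {:g} in
  \tr (passmx.mxof e e (ad x \o ad y)%VF).

Section Roots.
Variable H : {vspace g}.

Definition dual := 'Hom(subvs_of H, K^o).

Definition in_root_space (a : dual) (v : g) : Prop :=
  forall h : subvs_of H, b (vsval h) v = a h *: v.

Definition roots : set dual :=
  [set a | a != 0 /\ exists2 v, v != 0 & in_root_space a v].

Definition killing_dual : 'Hom(subvs_of H, dual) :=
  linfun (fun h : subvs_of H =>
    linfun (fun k : subvs_of H => killing (vsval h) (vsval k) : K^o) : dual).

(* The bilinear form on the dual of H transported from the Killing form; for H
   a Cartan subalgebra of a simple Lie algebra over the complex numbers
   killing_dual is bijective, so that ^-1 is a genuine inverse. *)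
Definition dual_form (a c : dual) : K := a ((killing_dual^-1)%VF c).

Definition reflection (a : dual) (c : dual) : dual :=
  c - (2%:R * dual_form c a / dual_form a a) *: a.

(* The product of the reflections in the elements of s; the order is
   irrelevant when these are mutually orthogonal. *)
Definition prod_reflections (s : seq dual) (c : dual) : dual :=
  foldr reflection c s.

Definition mutually_orthogonal (s : seq dual) : Prop :=
  forall a c, a \in s -> c \in s -> a != c -> dual_form a c = 0.

Definition nat_comb (s : seq dual) (c : dual) : Prop :=
  exists n : 'I_(size s) -> nat, c = \sum_(i < size s) s`_i *+ n i.

Definition simple_roots (D : set dual) (s : seq dual) : Prop :=
  [/\ free s,
      (forall a, a \in s -> D a) &
      (forall a, D a -> nat_comb s a \/ nat_comb s (- a))].

Definition positive_roots (D : set dual) (s : seq dual) : set dual :=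
  [set a | D a /\ nat_comb s a].

Definition highest_root (D : set dual) (s : seq dual) (a : dual) : Prop :=
  D a /\ (forall c, D c -> nat_comb s (a - c)).

(* c \o A^-1 on H, for an automorphism A of g that preserves H: the projection
   vsproj H is then only a cast. *)
Definition coadjoint (A : 'End(g)) (c : dual) : dual :=
  (c \o linfun (vsproj H) \o A^-1 \o linfun vsval)%VF.

End Roots.
End LieAlgebra.

Arguments roots {K g} b H.

Section Complex.
Variable R : realType.

(* B = exp A. The exponential series is required to converge after evaluation at
   each vector and each linear form, which in finite dimension is the same as
   convergence in norm. *)
Definition is_exp (g : vectType R[i]) (A B : 'End(g)) : Prop :=
  forall (f : 'Hom(g, R[i]^o)) (v : g),
    (fun n => \sum_(k < n) (k`!%:R)^-1 * f (iter k A v)) @ \oo --> f (B v).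

Definition expi (t : R) : R[i] := cos t +i* sin t.

Definition ray (z : R[i]) : set R[i] :=
  [set w | exists2 t : R, 0 <= t & w = t%:C * z].

(* d 1, ..., d n enumerate the set of rays S clockwise, within one full turn. *)
Definition clockwise_labelling (S : set (set R[i])) (n : nat)
    (d : nat -> set R[i]) : Prop :=
  [/\ exists theta : nat -> R,
        [/\ (forall i, (1 <= i <= n)%N -> d i = ray (expi (theta i))),
            (forall i j, (1 <= i)%N -> (i < j <= n)%N -> theta j < theta i) &
            theta 1%N - 2%:R * pi < theta n] &
      S = [set d i | i in [set i | (1 <= i <= n)%N]]].

Section SingularDirections.
Variables (g : vectType R[i]) (b : lieBracket g) (H : {vspace g}).

(* The value at x, which is meant to lie in H, of a linear form on H. *)
Definition dual_at (c : dual H) (x : g) : R[i] := c (vsproj H x).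

Definition singular_directions (E : g) : set (set R[i]) :=
  [set ray (dual_at c (- E)) | c in roots b H].

Definition roots_on (E : g) (d : nat -> set R[i]) (i : nat) : set (dual H) :=
  [set c | roots b H c /\ d i (dual_at c (- E))].

End SingularDirections.
End Complex.

Arguments roots_on {R g} b H E d i.

(* Main.v *)
From HB Require Import structures.
Require Import Defs.
From mathcomp Require Import ring lra zify.

Set Implicit Arguments.
Unset Strict Implicit.
Unset Printing Implicit Defensive.

Import Order.TTheory GRing.Theory Num.Theory.
Local Open Scope classical_set_scope.
Local Open Scope complex_scope.
Local Open Scope ring_scope.

(* The Coxeter element gamma rotates the numbers beta(-E) clockwise by 2 pi / s,
   since Ad P0 multiplies E by exp(2 pi i / s).  Let R_i be the set of roots on
   d_i.  As the 2s singular rays are permuted by this rotation and by -1, an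
   order argument gives gamma R_i = R_(i+2) and - R_i = R_(i+s), so that gamma
   maps a positive root to a negative one iff it lies in R_(s-1) or R_s.  On the
   other hand tau_k permutes the positive roots outside Pi_k, so the same roots
   form Pi_1 and tau_1 Pi_2.  Because R_1 is an extreme ray of the cone of
   positive roots, the simple roots occurring in a member of R_1 are again in
   R_1; this forces R_1 to lie in Pi_2 (a root p of Pi_1 in R_1 would satisfy
   gamma p = - p, impossible for s > 2), and symmetrically R_s in Pi_1.  Hence
   tau_1 Pi_2, disjoint from R_s, lies in R_(s-1), and applying - gamma gives
   Pi_2 inside R_1.

   The facts on roots come from the weights of sl2-strings; the nondegeneracy of
   the Killing form follows from simplicity because ad [x, y], for opposite root
   vectors with [x, y] <> 0, has eigenvalues rationally proportional to one
   nonzero number, so that its square has nonzero trace. *)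

(** * Roots of a simple Lie algebra *)

Section Eigenvectors.
Variables (K : fieldType) (V : vectType K) (T : Type) (f : T -> 'End(V)).
Implicit Types (l m : T -> K) (v : V).

Definition joint_eigen l v := forall t, f t v = l t *: v.

(** Choose [t] with [l j t != m t]. The operator [f t - l j t] kills [u j], rescales every other
    term and multiplies the whole sum by the nonzero [m t - l j t], so induction applies to the
    shorter list. *)
Lemma joint_eigen_sum0 (I : eqType) (r : seq I) (u : I -> V) (l : I -> T -> K) m :
  {in r, forall i, joint_eigen (l i) (u i)} ->
  {in r, forall i, exists t, l i t != m t} ->
  joint_eigen m (\sum_(i <- r) u i) -> \sum_(i <- r) u i = 0.
Proof.
elim: r u => [|j r IH] u ul lm; first by rewrite big_nil.
have jr : j \in j :: r by rewrite mem_head.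
have sr i : i \in r -> i \in j :: r by rewrite in_cons => ->; rewrite orbT.
rewrite big_cons; set w := _ + _ => wm.
have [t ljt] := lm j jr.
pose u' i := (l i t - l j t) *: u i.
have sumu' : \sum_(i <- r) u' i = (m t - l j t) *: w.
  rewrite scalerBl -wm /w linearD /= ul // scalerDr opprD addrACA subrr add0r.
  rewrite linear_sum scaler_sumr -sumrB; apply: eq_big_seq => i ir.
  by rewrite /u' scalerBl /= ul ?sr.
suff : \sum_(i <- r) u' i = 0.
  by move=> /eqP; rewrite sumu' scaler_eq0 subr_eq0 eq_sym (negPf ljt) => /eqP.
apply: IH => [i ir t'|i /sr/lm//|t'].
  by rewrite /u' linearZ /= ul ?sr // !scalerA mulrC.
by rewrite sumu' linearZ /= wm !scalerA mulrC.
Qed.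

End Eigenvectors.

Section Eigenvectors1.
Variables (K : numFieldType) (V : vectType K).

(** The eigenvalues [m + a *+ n] are distinct in characteristic zero, so a sequence without zeros
    would be free at every length, beyond the dimension of [V]. This is the source of nilpotency for
    root vectors. *)
Lemma eigenvector_sequence_vanishes (f : 'End(V)) (u : nat -> V) (m a : K) :
  a != 0 -> (forall n, f (u n) = (m + a *+ n) *: u n) -> exists n, u n = 0.
Proof.
move=> a0 fu; apply: contrapT => /forallNP un0.
have fr n : free (mkseq u n).
  elim: n => [|n IH]; first by rewrite /= nil_free.
  rewrite mkseqS -cats1 (perm_free (_ : perm_eq _ (u n :: mkseq u n))); last by rewrite perm_catC.
  rewrite free_cons IH andbT; apply/negP => /(@coord_span _ _ _ (in_tuple _)) E.
  apply: (un0 n); rewrite E.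
  apply: (@joint_eigen_sum0 _ _ unit (fun=> f) _ _ _
    (fun (i : 'I_(size (mkseq u n))) _ => m + a *+ i) (fun=> m + a *+ n)).
  - move=> i _ _; rewrite linearZ /= (_ : (mkseq u n)`_i = u i) ?fu ?scalerA 1?mulrC ?scalerA //.
    by rewrite nth_mkseq // (leq_trans (ltn_ord i)) // size_mkseq.
  - move=> i _; exists tt; have iltn : (i < n)%N by rewrite (leq_trans (ltn_ord i)) // size_mkseq.
    by rewrite (inj_eq (addrI _)) (inj_eq (mulrIn a0)) neq_ltn iltn.
  - by move=> _ /=; rewrite -[X in f X]E -[X in _ *: X]E fu.
have := fr (\dim {:V}).+1; rewrite /free size_mkseq => /eqP E.
by have := dimvS (subvf <<mkseq u (\dim {:V}).+1>>); rewrite E ltnn.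
Qed.

End Eigenvectors1.

(** * Strings of vectors under sl2 and Heisenberg triples *)

Section LieSl2.
Variables (K : numFieldType) (g : vectType K) (b : lieBracket g).

HB.instance Definition _ (x : g) :=
  GRing.isLinear.Build K g g _ (b x) (lie_linearr b x).

Lemma adE x y : ad b x y = b x y. Proof. exact: lfunE. Qed.

Lemma lieC x y : b x y = - b y x.
Proof.
have := lie_alt b (x + y); have H := lie_linearl b.
have Hl z u v : b (u + v) z = b u z + b v z by have := H z 1 u v; rewrite !scale1r.
rewrite Hl !linearD /= !lie_alt add0r addr0 => /eqP.
by rewrite addr_eq0 => /eqP.
Qed.

Lemma lieDl x y z : b (x + y) z = b x z + b y z.
Proof. by have := lie_linearl b z 1 x y; rewrite !scale1r. Qed.

Lemma lieZl a x z : b (a *: x) z = a *: b x z.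
Proof. by rewrite lieC linearZ /= -scalerN -lieC. Qed.

Lemma lie0l z : b 0 z = 0.
Proof. by rewrite lieC linear0 oppr0. Qed.

Lemma lieDr x y z : b x (y + z) = b x y + b x z.
Proof. exact: linearD. Qed.

Lemma lieZr a x y : b x (a *: y) = a *: b x y.
Proof. exact: linearZ. Qed.

Lemma lie_sumr x (I : Type) (r : seq I) (F : I -> g) :
  b x (\sum_(i <- r) F i) = \sum_(i <- r) b x (F i).
Proof. exact: linear_sum. Qed.

Lemma lie_derivation x y z : b x (b y z) = b (b x y) z + b y (b x z).
Proof.
have /eqP := lie_jacobi b x y z.
rewrite (lieC z x) linearN /= (lieC z (b x y)) -addrA -opprD subr_eq0 => /eqP ->.
by rewrite addrC.
Qed.

Lemma ad_lie x y : ad b (b x y) = ((ad b x \o ad b y) - (ad b y \o ad b x))%VF.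
Proof.
by apply/lfunP => z; rewrite !lfun_simp /= lie_derivation addrK.
Qed.

Lemma lie_iter_eigen h x c m v n :
  b h x = c *: x -> b h v = m *: v ->
  b h (iter n (b x) v) = (m + c *+ n) *: iter n (b x) v.
Proof.
move=> hx hv; elim: n => [|n IH]; first by rewrite /= hv mulr0n addr0.
by rewrite iterS lie_derivation hx lieZl IH linearZ /= -scalerDl addrCA -mulrS.
Qed.

Lemma lie_iter_eventually0 h x c m v :
  c != 0 -> b h x = c *: x -> b h v = m *: v -> exists n, iter n (b x) v = 0.
Proof.
move=> c0 hx hv; apply: (@eigenvector_sequence_vanishes _ _ (ad b h) _ m c c0) => n.
by rewrite adE; exact: lie_iter_eigen.
Qed.

Lemma last_nonzero_iter x v :
  v != 0 -> (exists n, iter n (b x) v = 0) ->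
  exists n, (forall k, (k <= n)%N -> iter k (b x) v != 0) /\ b x (iter n (b x) v) = 0.
Proof.
move=> v0 [n0 E0].
have ex : exists n, iter n (b x) v == 0 by exists n0; rewrite E0.
case: (ex_minnP ex) => -[|n] /eqP En minn; first by rewrite -En eqxx in v0.
exists n; split=> // k kn; apply/negP => /minn; by rewrite ltnNge kn.
Qed.

(** Moving [x] past the factors [y] one at a time adds up the [h]-eigenvalues [m - a k] for [k] from
    0 to [n]; the coefficient is this arithmetic sum. *)
Lemma sl2_lowering x y h a m v n :
  b x y = h -> b h y = - a *: y -> b h v = m *: v -> b x v = 0 ->
  b x (iter n.+1 (b y) v) =
    (n.+1%:R * (m - a * n%:R / 2%:R)) *: iter n (b y) v.
Proof.
move=> xy hy hv xv; elim: n => [|n IH].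
  by rewrite /= lie_derivation xy hv xv linear0 mulr0 mul0r subr0 mul1r addr0.
rewrite iterS lie_derivation xy (lie_iter_eigen _ hy hv) IH linearZ /= -scalerDl.
congr (_ *: _); rewrite -mulr_natr -!(natr1 n) -(natr1 n.+1) -(natr1 n).
by field; rewrite ?pnatr_eq0.
Qed.

(* Both the sl2 case (a = 2) and the Heisenberg case (a = 0) are used, hence the
   auxiliary element h0 that makes ad x and ad y nilpotent on v. *)
Lemma sl2_string x y h h0 a c m m0 v :
  b x y = h -> b h x = a *: x -> b h y = - a *: y ->
  c != 0 -> b h0 x = c *: x -> b h0 y = - c *: y ->
  v != 0 -> b h v = m *: v -> b h0 v = m0 *: v ->
  exists r n, [/\ m = a * (n%:R / 2%:R - r%:R),
    b x (iter r (b x) v) = 0,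
    iter r (b x) v != 0 &
    (forall k, (k <= n)%N -> iter k (b y) (iter r (b x) v) != 0)].
Proof.
move=> xy hx hy c0 h0x h0y v0 hv h0v.
have [r [rn0 xr]] := last_nonzero_iter v0 (lie_iter_eventually0 c0 h0x h0v).
have w0 := rn0 r (leqnn r).
have hw := lie_iter_eigen r hx hv; have h0w := lie_iter_eigen r h0x h0v.
have c0' : - c != 0 by rewrite oppr_eq0.
have [n [nn0 yn]] := last_nonzero_iter w0 (lie_iter_eventually0 c0' h0y h0w).
exists r, n; split=> //.
(* The top vector has [h]-eigenvalue [m + a *+ r] and the string below it stops after [n] steps, so
   the coefficient in [sl2_lowering] vanishes there. *)
have := sl2_lowering n xy hy hw xr; rewrite iterS yn linear0 => /esym/eqP.
rewrite scaler_eq0 (negPf (nn0 n _)) // orbF mulf_eq0 pnatr_eq0 /= => /eqP E.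
have -> : m = (m + a *+ r - a * n%:R / 2%:R) + a * (n%:R / 2%:R) - a * r%:R.
  by rewrite -(mulr_natr a r); ring.
by rewrite E add0r -mulrBr.
Qed.

End LieSl2.

Lemma linfun_linearE (K : fieldType) (aT rT : vectType K) (f : aT -> rT) :
  linear f -> linfun f =1 f.
Proof.
move=> L; pose F := GRing.isLinear.Build K aT rT _ f L.
exact: (@lfunE _ _ _ (HB.pack f F : {linear aT -> rT})).
Qed.

(** * Weights of a Cartan subalgebra *)

Section WeightDecomposition.
Variables (K : numFieldType) (g : vectType K) (b : lieBracket g) (H : {vspace g}).
Hypothesis hH : cartan_subalgebra b H.

Let wsub h k : h \in H -> k \in H -> b h k = 0.
Proof. by case: hH => hab _ _; exact: hab. Qed.

(** Adjoining [x] to [H] leaves it abelian, and [H] is maximal among abelian subspaces. *)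
Lemma cartan_self_centralizing x : (forall h, h \in H -> b h x = 0) -> x \in H.
Proof.
move=> hx; have [_ maxH _] := hH.
suff /maxH <- : lie_commutes b (H + <[x]>) (H + <[x]>).
- by apply: (subvP (addvSr _ _)); exact: memv_line.
- exact: addvSl.
move=> _ _ /memv_addP[h hh [_ /vlineP[s ->] ->]] /memv_addP[k hk [_ /vlineP[t ->] ->]].
rewrite lieDr !lieDl !lieZr !lieZl (wsub hh hk) (hx h hh) lie_alt.
by rewrite lieC hx // oppr0 !scaler0 !addr0.
Qed.

Lemma exists_functional (v : g) : v != 0 -> exists f : 'Hom(g, K^o), f v = 1.
Proof.
move=> v0; have vf : v \in {:g}%VS by rewrite memvf.
have [i /eqP ci] : exists i, coord (vbasis {:g}) i v != 0.
  apply/existsP; apply: contraR v0 => /existsPn ci0.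
  rewrite (coord_vbasis vf) big1 // => i _.
  by have := ci0 i; rewrite negbK => /eqP ->; rewrite scale0r.
pose f w : K^o := (coord (vbasis {:g}) i v)^-1 * coord (vbasis {:g}) i w.
exists (linfun f); rewrite linfun_linearE => [|s u w].
  by rewrite /f mulVf //; apply/eqP.
by rewrite /f linearP /= mulrDr mulrCA.
Qed.

(** Simultaneous diagonalization by induction on [hs]: a joint eigenvector of the tail is cut into
    its components in the eigenspaces of [ad b h], and these stay eigenvectors of the tail because
    the operators commute. *)
Lemma joint_decomposition (hs : seq g) v : {subset hs <= H} ->
  exists r : seq g, v = \sum_(u <- r) u /\
    forall u h, u \in r -> h \in hs -> exists m : K, b h u = m *: u.
Proof.
move=> hsH.
pose S (hs : seq g) v := exists r : seq g, v = \sum_(u <- r) u /\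
    forall u h, u \in r -> h \in hs -> exists m : K, b h u = m *: u.
have Ssum hs' I (r : seq I) (F : I -> g) : (forall i, S hs' (F i)) -> S hs' (\sum_(i <- r) F i).
  move=> SF; elim: r => [|i r [r1 [E1 H1]]]; first by exists [::]; rewrite !big_nil.
  have [r2 [E2 H2]] := SF i; exists (r2 ++ r1); rewrite big_cons big_cat -E2 -E1; split=> //.
  by move=> u h; rewrite mem_cat => /orP[] uu; [apply: H2|apply: H1].
change (S hs v); elim: hs hsH v => [|h hs IH] hsH v.
  by exists [:: v]; rewrite big_seq1; split.
have hH' : h \in H by apply: hsH; rewrite mem_head.
have hsH' : {subset hs <= H} by move=> k kk; apply: hsH; rewrite in_cons kk orbT.
have [r [-> Hr]] := IH hsH' v.
rewrite big_seq_cond big_mkcond /=; apply: (Ssum) => u.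
case: ifP => [|_]; last by exists [::]; rewrite big_nil.
rewrite andbT => ur.
have [_ _ /(_ h hH')[X [Xb XE]]] := hH.
have [m mE] : exists m : 'I_(size X) -> K, forall i : 'I_(size X), b h X`_i = m i *: X`_i.
  have ex (i : 'I_(size X)) : exists a, b h X`_i = a *: X`_i.
    by have [a] := XE X`_i (mem_nth _ (ltn_ord i)); rewrite adE; exists a.
  by exists (fun i => sval (cid (ex i))) => i; case: cid.
have Xb' : basis_of fullv (in_tuple X) by [].
pose cu i := coord (in_tuple X) i u *: X`_i.
pose p (z : K) := \sum_(i | m i == z) cu i.
have pE z : b h (p z) = z *: p z.
  rewrite /p -adE linear_sum scaler_sumr; apply: eq_bigr => i /eqP <-.
  by rewrite linearZ /= adE mE !scalerA mulrC.
have up : u = \sum_(z <- undup [seq m i | i : 'I_(size X)]) p z.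
  rewrite (coord_basis Xb' (memvf u)) /p (exchange_big_dep predT) //=.
  apply: eq_bigr => i _; rewrite -big_filter.
  rewrite (_ : [seq _ <- _ | _] = [:: m i]) ?big_seq1 //.
  rewrite -(@filter_pred1_uniq _ (undup [seq m i0 | i0 : 'I_(size X)]) (m i)) ?undup_uniq //.
    by apply: eq_filter => z; rewrite /= eq_sym.
  by rewrite mem_undup map_f // mem_enum.
exists (map p (undup [seq m i | i : 'I_(size X)])); rewrite big_map; split=> // w k.
case/mapP => z zm ->; rewrite in_cons => /predU1P[->|kk]; first by exists z.
have [s ks] := Hr u k ur kk; exists s.
have kE y : b h (b k y) = b k (b h y).
  by rewrite lie_derivation (wsub hH' (hsH' _ kk)) lie0l add0r.
(* [d y] is the defect of [p y] as an eigenvector of [k] for [s]. The defects lie in distinct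
   eigenspaces of [ad b h] and sum to zero, so each of them is zero. *)
pose d y := b k (p y) - s *: p y.
have dE y : b h (d y) = y *: d y.
  by rewrite /d lieDr -scaleNr lieZr kE pE lieZr scalerDr !scalerA mulrC.
have d0 : \sum_(y <- undup [seq m i | i : 'I_(size X)]) d y = 0.
  by rewrite sumrB -lie_sumr -scaler_sumr -up ks subrr.
apply/eqP; rewrite -subr_eq0 -/(d z); apply/eqP.
move: d0; rewrite (bigD1_seq z) ?undup_uniq //= => /eqP; rewrite addr_eq0 => /eqP E.
have := @joint_eigen_sum0 _ _ unit (fun=> ad b h) _
  [seq y <- undup [seq m i | i : 'I_(size X)] | y != z] d (fun y _ => y) (fun=> z).
rewrite big_filter E => -> //; rewrite ?oppr0 //.
- by move=> y _ _; rewrite adE dE.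
- by move=> y; rewrite mem_filter => /andP[yz _]; exists tt.
- by move=> _; rewrite -[X in ad b h X]opprK -E linearN /= adE dE E scalerN opprK.
Qed.
End WeightDecomposition.

Section Weights.
Variables (K : numFieldType) (g : vectType K) (b : lieBracket g) (H : {vspace g}).
Hypothesis hH : cartan_subalgebra b H.

(** A form [f] with [f u = 1] reads off the eigenvalue of [h] as [f (b h u)], which is visibly
    linear in [h]. *)
Lemma joint_eigen_weight (u : g) : u != 0 ->
  (forall h, h \in vbasis H -> exists m : K, b h u = m *: u) ->
  exists a : dual H, in_root_space b a u.
Proof.
move=> u0 hu; have [f fu] := exists_functional u0.
have sub : (H <= ad b u @^-1: <[u]>)%VS.
  rewrite -(span_basis (vbasisP H)); apply/span_subvP => h hh.
  rewrite -memv_preim adE lieC; have [m ->] := hu h hh.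
  by rewrite rpredN; apply/vlineP; exists m.
have L : linear (fun h : subvs_of H => f (b (vsval h) u)).
  by move=> t h k; rewrite linearP lieDl lieZl linearP.
exists (linfun (fun h : subvs_of H => f (b (vsval h) u))) => h.
rewrite linfun_linearE //.
have := subvP sub _ (subvsP h); rewrite -memv_preim adE => /vlineP[m E].
by rewrite lieC E -scaleNr linearZ /= fu /= /GRing.scale /= mulr1.
Qed.

Lemma weight_decomposition v :
  exists r : seq (dual H * g), v = \sum_(p <- r) p.2 /\
    forall p, p \in r -> in_root_space b p.1 p.2 /\ p.2 != 0.
Proof.
have sH : {subset vbasis H <= H} by move=> x; exact: vbasis_mem.
have [r [-> Hr]] := joint_decomposition hH v sH.
have [w wE] : exists w : g -> dual H, forall u, u \in r -> u != 0 -> in_root_space b (w u) u.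
  have ex u : exists a : dual H, u \in r -> u != 0 -> in_root_space b a u.
    have [ur|] := boolP (u \in r); last by exists 0.
    have [->|u0] := eqVneq u 0; first by exists 0.
    have [|a aE] := joint_eigen_weight u0; last by exists a.
    by move=> h; exact: Hr.
  by exists (fun u => sval (cid (ex u))) => u; case: cid.
exists [seq (w u, u) | u <- r & u != 0]; rewrite big_map big_filter; split.
  by rewrite [RHS]big_mkcond /=; apply: eq_bigr => u _; case: eqVneq.
by move=> p /mapP[u]; rewrite mem_filter => /andP[u0 ur] ->; split=> //; apply: wE.
Qed.

Lemma weight_sum0 (r : seq (dual H * g)) (m : dual H) :
  {in r, forall p, in_root_space b p.1 p.2 /\ p.1 != m} ->
  in_root_space b m (\sum_(p <- r) p.2) -> \sum_(p <- r) p.2 = 0.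
Proof.
move=> Hr Hm.
apply: (@joint_eigen_sum0 _ _ _ (fun h : subvs_of H => ad b (vsval h)) _ r snd
  (fun p h => p.1 h) m).
- by move=> p /Hr[pE _] h; rewrite adE; exact: pE.
- move=> p /Hr[_ /eqP pm]; apply: contrapT => /forallNP nex; apply: pm.
  by apply/lfunP => h; apply/eqP; have /negP := nex h; rewrite negbK.
- by move=> h; rewrite adE; exact: Hm.
Qed.

Lemma weight0_in_cartan v : in_root_space b (0 : dual H) v -> v \in H.
Proof.
move=> hv; apply: (cartan_self_centralizing hH) => h hh.
by have := hv (vsproj H h); rewrite vsprojK // lfunE /= scale0r.
Qed.

Lemma cartan_weight0 v : v \in H -> in_root_space b (0 : dual H) v.
Proof.
move=> hv h; rewrite lfunE /= scale0r; have [hab _ _] := hH.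
by apply: hab => //; exact: subvsP.
Qed.

Lemma in_root_spaceZ (a : dual H) s v : in_root_space b a v -> in_root_space b a (s *: v).
Proof. by move=> hv h; rewrite lieZr hv !scalerA mulrC. Qed.

Lemma in_root_space_lie (a c : dual H) x y :
  in_root_space b a x -> in_root_space b c y -> in_root_space b (a + c) (b x y).
Proof.
by move=> hx hy h; rewrite lie_derivation hx hy lieZl lieZr -scalerDl add_lfunE.
Qed.

Lemma in_root_space_iter (a c : dual H) x y n :
  in_root_space b a x -> in_root_space b c y ->
  in_root_space b (c + a *+ n) (iter n (b x) y).
Proof.
move=> hx hy; elim: n => [|n IH]; first by rewrite mulr0n addr0.
by rewrite iterS mulrS addrCA; apply: in_root_space_lie.
Qed.

Lemma nonzero_dual (a : dual H) : a != 0 -> exists h, a h != 0.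
Proof.
move=> /eqP a0; apply: contrapT => /forallNP nex; apply: a0; apply/lfunP => h.
by rewrite [RHS]lfunE; apply/eqP; have /negP := nex h; rewrite negbK.
Qed.

Lemma in_root_space_unique (a c : dual H) v :
  v != 0 -> in_root_space b a v -> in_root_space b c v -> a = c.
Proof.
move=> v0 hv hv'; apply/lfunP => h; apply/eqP; rewrite -subr_eq0.
have := subrr (b (vsval h) v); rewrite {1}hv hv' -scalerBl => /eqP.
by rewrite scaler_eq0 (negPf v0) orbF.
Qed.

End Weights.

(** * Traces and the Killing form *)

Section Trace.
Variables (K : fieldType) (V : vectType K).
Implicit Types (f h : 'End(V)).

(** The basis is the one used in [killing], so that [killingE] holds by conversion. *)
Definition end_trace f : K :=
  let e := vbasis {:V} in \tr (passmx.mxof e e f).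

Lemma end_traceC f h : end_trace (f \o h)%VF = end_trace (h \o f)%VF.
Proof.
have eb := vbasisP {:V}.
by rewrite /end_trace !(passmx.mxof_comp _ _ eb) mxtrace_mulC.
Qed.

Lemma end_traceP a f h : end_trace (a *: f + h) = a * end_trace f + end_trace h.
Proof. by rewrite /end_trace passmx.mxof_linear mxtraceD mxtraceZ. Qed.

Lemma end_traceB f h : end_trace (f - h) = end_trace f - end_trace h.
Proof. by rewrite addrC -scaleN1r end_traceP mulN1r addrC. Qed.

Lemma end_trace_basis (X : (\dim {:V}).-tuple V) f : basis_of fullv X ->
  end_trace f = \sum_i coord X i (f X`_i).
Proof.
move=> Xb; have eb := vbasisP {:V}; rewrite /end_trace /=.
rewrite -[in LHS](comp_lfun1l f) (passmx.mxof_comp _ _ Xb) mxtrace_mulC.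
rewrite -(passmx.mxof_comp _ _ eb) comp_lfun1r.
by apply: eq_bigr => i _; rewrite !mxE /= passmx.vecof_delta.
Qed.

End Trace.

Section TraceSquare.
Variables (K : numFieldType) (V : vectType K).

(** In an eigenbasis the trace of the square is a sum of squares of real numbers, so every
    eigenvalue is zero. *)
Lemma diagonalizable_trace_square0 (f : 'End(V)) :
  diagonalizable_end f ->
  (forall v m, v != 0 -> f v = m *: v -> m \is Num.real) ->
  end_trace (f \o f)%VF = 0 -> f = 0.
Proof.
move=> [X [Xb XE]] fr.
have sX : size X == \dim {:V}.
  by have /andP[/eqP <- /eqP ->] := Xb.
pose Xt := Tuple sX; have Xtb : basis_of fullv Xt := Xb.
have [m mE] : exists m : 'I_(\dim {:V}) -> K, forall i : 'I_(\dim {:V}), f Xt`_i = m i *: Xt`_i.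
  have ex (i : 'I_(\dim {:V})) : exists a, f Xt`_i = a *: Xt`_i.
    by apply: XE; rewrite mem_nth // (eqP sX).
  by exists (fun i => sval (cid (ex i))) => i; case: cid.
have X0 (i : nat) : (i < \dim {:V})%N -> Xt`_i != 0.
  by move=> il; apply: (free_not0 (basis_free Xb)); rewrite mem_nth // (eqP sX).
rewrite (end_trace_basis _ Xtb) => E.
have m0 i : m i = 0.
  move: E; rewrite (eq_bigr (fun i => m i ^+ 2)); last first.
    move=> j _; rewrite comp_lfunE mE !linearZ /= mE linearZ /=.
    by rewrite coord_free ?(basis_free Xb) // eqxx mulr1 expr2.
  have mr j : 0 <= m j ^+ 2 by rewrite real_exprn_even_ge0 // (fr _ _ (X0 j (ltn_ord j)) (mE j)).
  move/eqP; rewrite psumr_eq0; last by move=> j _.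
  by move=> /allP /(_ i (mem_index_enum i)) /=; rewrite expf_eq0 /= => /eqP.
apply/lfunP => v; rewrite [v](coord_basis Xtb (memvf v)) linear_sum lfunE /=.
by apply: big1 => i _; rewrite linearZ /= mE m0 scale0r scaler0.
Qed.

End TraceSquare.

Section Killing.
Variables (K : numFieldType) (g : vectType K) (b : lieBracket g).
Implicit Types (x y z : g).

Lemma killingE x y : killing b x y = end_trace (ad b x \o ad b y)%VF.
Proof. by []. Qed.

Lemma killingC x y : killing b x y = killing b y x.
Proof. exact: end_traceC. Qed.

Lemma killing_inv x y z : killing b (b x y) z = killing b x (b y z).
Proof.
rewrite !killingE !ad_lie comp_lfunDl comp_lfunDr comp_lfunNl comp_lfunNr.
rewrite !end_traceB comp_lfunA; congr (_ - _).
by rewrite -comp_lfunA end_traceC comp_lfunA.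
Qed.

Lemma killing_linear x : linear (killing b x : g -> K^o).
Proof.
move=> a y z; rewrite !killingE.
have -> : ad b (a *: y + z) = a *: ad b y + ad b z.
  by apply/lfunP => w; rewrite add_lfunE scale_lfunE !adE lieDl lieZl.
by rewrite comp_lfunDr -comp_lfunZr end_traceP.
Qed.

HB.instance Definition _ x :=
  GRing.isLinear.Build K g K^o _ (killing b x) (killing_linear x).

Lemma killing_lie_swap x y z : killing b (b x y) z = - killing b y (b x z).
Proof. by rewrite lieC -[- _]scaleN1r killingC linearZ /= killingC killing_inv scaleN1r. Qed.

End Killing.

(** * Nondegeneracy of the Killing form, root strings and reflections *)

Section SimpleLie.
Variables (K : numFieldType) (g : vectType K) (b : lieBracket g).
Hypothesis hsimple : lie_simple b.
Variable H : {vspace g}.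
Hypothesis hH : cartan_subalgebra b H.

Lemma central_eq0 h : (forall x, b h x = 0) -> h = 0.
Proof.
move=> hc; have [[x [y xy]] /(_ <[h]>%VS) hI] := hsimple.
case: hI => [u _ /vlineP[t ->]|hl|hl].
- by rewrite lieZr lieC hc oppr0 scaler0 mem0v.
- by apply/eqP; rewrite -memv0 -hl memv_line.
- have : x \in <[h]>%VS by rewrite hl memvf.
  by move=> /vlineP[t xE]; rewrite xE lieZl hc scaler0 eqxx in xy.
Qed.

Lemma lie_opposite_in_cartan (a : dual H) x y :
  in_root_space b a x -> in_root_space b (- a) y -> b x y \in H.
Proof.
move=> hx hy; apply: (weight0_in_cartan hH).
by rewrite -(subrr a); exact: in_root_space_lie.
Qed.

(** If [a k = 0], then [x], [y], [k] form a Heisenberg triple, and the case [a = 0] of [sl2_string]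
    makes [k] act by zero on every weight vector. Then [k] is central, hence zero. An [h0] with
    [a h0 != 0] supplies the nilpotency. *)
Lemma lie_opposite_neq0 (a : dual H) x y (k : subvs_of H) :
  a != 0 -> in_root_space b a x -> in_root_space b (- a) y ->
  b x y = vsval k -> b x y != 0 -> a k != 0.
Proof.
move=> a0 hx hy xyE; apply: contra => /eqP ak; apply/eqP/central_eq0 => v.
have [r [-> Hr]] := weight_decomposition hH v.
rewrite lie_sumr big_seq big1 // => p /Hr[hp p0].
have [h0 ah0] := nonzero_dual a0.
have [] := @sl2_string _ _ b x y (b x y) (vsval h0) 0 (a h0) (p.1 k) (p.1 h0) p.2 => //.
- by rewrite xyE hx ak.
- by rewrite xyE hy opp_lfunE ak.
- by rewrite hy opp_lfunE.
- by rewrite xyE.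
by move=> r' [n [pk _ _ _]]; rewrite xyE hp pk mul0r scale0r.
Qed.

Lemma dual_basis_neq0 (a : dual H) : a != 0 ->
  exists i : 'I_(\dim H), a (vsproj H (vbasis H)`_i) != 0.
Proof.
move=> a0; apply: contrapT => /forallNP nex; move/negP: a0; apply.
apply/eqP/lfunP => h; rewrite lfunE /= -(vsvalK h) (coord_vbasis (subvsP h)).
rewrite !linear_sum big1 // => i _; rewrite !linearZ /=.
by have /negP := nex i; rewrite negbK => /eqP ->; rewrite scaler0.
Qed.

(** This is [H, g], the sum of all root spaces; the next two facts are the two inclusions. *)
Let N := (\sum_(i < \dim H) limg (ad b (vbasis H)`_i))%VS.

Let weight_in_N (a : dual H) v : a != 0 -> in_root_space b a v -> v \in N.
Proof.
move=> a0 hv; have [i ai] := dual_basis_neq0 a0.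
apply: (subvP (sumv_sup i (erefl _) (subvv _))).
set h := (vbasis H)`_i in ai *.
have hhH : h \in H by rewrite vbasis_mem // mem_nth // size_tuple.
have -> : v = (a (vsproj H h))^-1 *: ad b h v.
  by rewrite adE -[in b h](vsprojK hhH) hv scalerA mulVf // scale1r.
by rewrite memvZ // memv_img // memvf.
Qed.

Let N_weights v : v \in N -> exists r : seq (dual H * g), v = \sum_(p <- r) p.2 /\
  forall p, p \in r -> in_root_space b p.1 p.2 /\ p.1 != 0.
Proof.
case/memv_sumP => w wE ->.
have ex i : exists r : seq (dual H * g), w i = \sum_(p <- r) p.2 /\
  forall p, p \in r -> in_root_space b p.1 p.2 /\ p.1 != 0.
  have := wE i (erefl _); case/memv_imgP => u _ ->.
  have [r [-> Hr]] := weight_decomposition hH u.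
  exists [seq (p.1, ad b (vbasis H)`_i p.2) | p <- r & p.1 != 0]; split.
    rewrite linear_sum big_map big_filter [RHS]big_mkcond /=.
    rewrite big_seq [RHS]big_seq; apply: eq_bigr => p /Hr[hp _].
    case: eqVneq hp => //= -> hp; rewrite adE.
    have hhH : (vbasis H)`_i \in H by rewrite vbasis_mem // mem_nth // size_tuple.
    by have := hp (vsproj H (vbasis H)`_i); rewrite vsprojK // lfunE /= scale0r.
  move=> p /mapP[q]; rewrite mem_filter => /andP[q0 /Hr[hq _]] -> /=; split=> // h.
  rewrite adE.
  have hhH : (vbasis H)`_i \in H by rewrite vbasis_mem // mem_nth // size_tuple.
  by rewrite -(vsprojK hhH) hq; apply: in_root_spaceZ.
exists (flatten [seq sval (cid (ex i)) | i <- enum 'I_(\dim H)]); split.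
  rewrite big_flatten big_map big_enum; apply: eq_bigr => i _.
  by case: cid => r [].
by move=> p /flattenP[s /mapP[i _ ->]]; case: cid => r /= [_ Hr]; exact: Hr.
Qed.

(** Otherwise [N] is an ideal. If [N] is zero, then g equals [H] and is abelian; if [N] is all of g,
    then [H] is zero, and being self-centralizing it forces g to be zero. *)
Lemma exists_nonzero_opposite_lie : exists (a : dual H) x y,
  [/\ a != 0, in_root_space b a x, in_root_space b (- a) y & b x y != 0].
Proof.
apply: contrapT => nex.
have z (a : dual H) x y : a != 0 -> in_root_space b a x -> in_root_space b (- a) y -> b x y = 0.
  move=> a0 hx hy; apply/eqP; rewrite -[_ == _]negbK; apply/negP => xy.
  by apply: nex; exists a, x, y.
have [[x0 [y0 xy0]] /(_ N)[|N0|Nf]] := hsimple.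
- move=> x y /N_weights[r [-> Hr]].
  have [s [-> Hs]] := weight_decomposition hH x.
  rewrite lie_sumr big_seq; apply: memv_suml => p /Hr[hp p0].
  rewrite lieC lie_sumr rpredN big_seq; apply: memv_suml => q /Hs[hq q0].
  have [pq|pq] := eqVneq (p.1 + q.1) 0; last first.
    exact: weight_in_N pq (in_root_space_lie hp hq).
  rewrite (z p.1) ?mem0v //; move/eqP: pq; rewrite addr_eq0 => /eqP ->.
  by rewrite opprK.
- have inH x : x \in H.
    have [s [-> Hs]] := weight_decomposition hH x.
    rewrite big_seq; apply: memv_suml => p /Hs[hp p0].
    have [E|p10] := eqVneq p.1 0; first by apply: (weight0_in_cartan hH); rewrite -E.
    by have := weight_in_N p10 hp; rewrite N0 memv0 (negPf p0).
  by have [hab _ _] := hH; rewrite hab ?eqxx in xy0.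
- have H0 h : h \in H -> h = 0.
    move=> hh; have : h \in N by rewrite Nf memvf.
    case/N_weights => r [E Hr]; rewrite E; apply: (weight_sum0 (m := 0 : dual H)) Hr _.
    by rewrite -E; apply: (cartan_weight0 hH).
  have x00 : x0 = 0.
    by apply/H0/(cartan_self_centralizing hH) => h /H0 ->; rewrite lie0l.
  by rewrite x00 lie0l eqxx in xy0.
Qed.

Lemma killing_nondegenerate x : (forall y, killing b x y = 0) -> x = 0.
Proof.
pose L x : 'Hom(g, K^o) := linfun (killing b x).
have LE u v : L u v = killing b u v by rewrite lfunE.
have Ll : linear L.
  move=> t u v; apply/lfunP => w.
  by rewrite add_lfunE scale_lfunE !LE ![killing b _ w]killingC linearP.
have memR u : (u \in lker (linfun L)) = (L u == 0) by rewrite memv_ker linfun_linearE.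
have [_ /(_ (lker (linfun L)))[u v|R0|Rf]] := hsimple.
- rewrite !memR => /eqP v0; apply/eqP/lfunP => w.
  by rewrite LE killing_lie_swap -LE v0 !lfunE oppr0.
- move=> x0; apply/eqP; rewrite -memv0 -R0 memR; apply/eqP/lfunP => w.
  by rewrite LE x0 lfunE.
have k0 u v : killing b u v = 0.
  have : u \in lker (linfun L) by rewrite Rf memvf.
  by rewrite memR => /eqP E; rewrite -LE E lfunE.
have [a [u [v [a0 hu hv uv0]]]] := exists_nonzero_opposite_lie.
have uvH := lie_opposite_in_cartan hu hv.
have uvE := esym (vsprojK uvH); set k := vsproj H _ in uvE.
have ak := lie_opposite_neq0 a0 hu hv uvE uv0.
(* After this scaling [a] takes the value 2 on [h], so [sl2_string] gives eigenvalues
   [2 (n / 2 - r)] of [ad b h]. They are real, and a vanishing Killing square would force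
   [ad b h = 0]. *)
pose u' := (2%:R / a k) *: u; pose h := b u' v.
have hE : h = vsval ((2%:R / a k) *: k) by rewrite /h lieZl uvE linearZ.
have ah : a ((2%:R / a k) *: k) = 2%:R by rewrite linearZ /= [_ *: _]mulfVK.
have hu' : in_root_space b a u' by apply: in_root_spaceZ.
have adh0 : ad b h = 0.
  apply: diagonalizable_trace_square0; last exact: k0.
    by have [_ _ hd] := hH; apply: hd; rewrite hE subvsP.
  move=> w m w0; rewrite adE => hw.
  have [] := @sl2_string _ _ b u' v h h 2%:R 2%:R m m w => //.
  - by rewrite hE hu' ah.
  - by rewrite hE hv opp_lfunE ah.
  - by rewrite hE hu' ah.
  - by rewrite hE hv opp_lfunE ah.
  by move=> r [n [-> _ _ _]]; rewrite !(realM, realB, realV, realn).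
have := adE b h u; rewrite adh0 lfunE /= hE hu ah => /esym/eqP.
rewrite scaler_eq0 pnatr_eq0 /= => /eqP u0.
by rewrite u0 lie0l eqxx in uv0.
Qed.

Lemma killing_weight_orthogonal (a c : dual H) x y :
  in_root_space b a x -> in_root_space b c y -> a + c != 0 -> killing b x y = 0.
Proof.
move=> hx hy /nonzero_dual[h ach].
have : a h * killing b x y = - (c h * killing b x y).
  have := killing_lie_swap b (vsval h) x y.
  by rewrite hx hy killingC !linearZ /= killingC.
move/eqP; rewrite -addr_eq0 -mulrDl mulf_eq0.
by have := ach; rewrite add_lfunE => /negPf ->; move=> /eqP.
Qed.

Lemma killing_dualE h k : killing_dual b H h k = killing b (vsval h) (vsval k).
Proof.
have L1 u : linear (fun k : subvs_of H => killing b (vsval u) (vsval k) : K^o).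
  by move=> t v w; rewrite !linearP.
have L2 : linear (fun h : subvs_of H =>
    linfun (fun k : subvs_of H => killing b (vsval h) (vsval k) : K^o) : dual H).
  move=> t u v; apply/lfunP => w.
  rewrite add_lfunE scale_lfunE !linfun_linearE //.
  by rewrite ![killing b _ (vsval w)]killingC !linearP.
by rewrite /killing_dual !linfun_linearE.
Qed.

(** [H] is orthogonal to all nonzero weight spaces, so a kernel element is orthogonal to all of g.
    This is what makes the inverse in [dual_form] cancel [killing_dual]. *)
Lemma killing_dual_ker0 : lker (killing_dual b H) == 0%VS.
Proof.
rewrite -subv0; apply/subvP => h; rewrite memv_ker memv0 => /eqP h0.
rewrite -(inj_eq val_inj) /=; apply/eqP/killing_nondegenerate => y.
have [r [-> Hr]] := weight_decomposition hH y.
rewrite linear_sum big_seq big1 //= => p /Hr[hp _].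
have h_wt := cartan_weight0 hH (subvsP h).
have [p0|p0] := eqVneq p.1 0; last first.
  by rewrite (killing_weight_orthogonal h_wt hp) // add0r.
have pH : p.2 \in H by apply: (weight0_in_cartan hH); rewrite -p0.
by rewrite -(vsprojK pH) -killing_dualE h0 lfunE.
Qed.

Lemma root_opposite_vector (a : dual H) x : in_root_space b a x -> x != 0 ->
  exists y, in_root_space b (- a) y /\ killing b x y != 0.
Proof.
move=> hx x0; apply: contrapT => nex; move/eqP: x0; apply; apply: killing_nondegenerate => y.
have [r [-> Hr]] := weight_decomposition hH y.
rewrite linear_sum big_seq big1 //= => p /Hr[hp _].
have [E|p0] := eqVneq (a + p.1) 0; last by rewrite (killing_weight_orthogonal hx hp).
move/eqP: E; rewrite addrC addr_eq0 => /eqP E.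
apply/eqP; rewrite -[_ == _]negbK; apply/negP => xy; apply: nex; exists p.2.
by rewrite -E.
Qed.

Lemma roots_opp (a : dual H) : roots b H a -> roots b H (- a).
Proof.
move=> [a0 [x x0 hx]]; split; first by rewrite oppr_eq0.
have [y [hy xy]] := root_opposite_vector hx x0.
by exists y => //; apply: contraNneq xy => ->; rewrite linear0.
Qed.

(** The vector [t], a multiple of the bracket of [x] and [y], represents [a] under the Killing form.
    Hence [dual_form] with [a] is evaluation at a multiple of [k], and normalizing by [a k = 2]
    turns [k] into the coroot. *)
Lemma root_sl2_triple (a : dual H) : roots b H a ->
  exists x y (k : subvs_of H),
  [/\ in_root_space b a x, in_root_space b (- a) y, b x y = vsval k, a k = 2%:R &
      forall c, reflection b a c = c - c k *: a].
Proof.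
move=> [a0 [x x0 hx]]; have [y [hy xy]] := root_opposite_vector hx x0.
have := vsprojK (lie_opposite_in_cartan hx hy); set k := vsproj H _ => kE.
pose t := (killing b x y)^-1 *: k.
have tE : killing_dual b H t = a.
  apply/lfunP => h; rewrite killing_dualE /t linearZ /= kE.
  rewrite [killing b (_ *: _) _]killingC linearZ /=.
  rewrite -killing_inv hx [killing b (_ *: _) y]killingC linearZ /= [killing b y x]killingC.
  by rewrite /GRing.scale /= mulrCA mulVf ?mulr1.
have ak : a k != 0.
  apply: (lie_opposite_neq0 a0 hx hy (esym kE)); rewrite -kE.
  apply: contraNneq a0 => k0.
  by rewrite -tE /t (_ : k = 0) ?scaler0 ?linear0 //; apply: val_inj; rewrite /= k0.
have fE c : dual_form b c a = (killing b x y)^-1 * c k.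
  by rewrite /dual_form -{1}tE (lker0_lfunK killing_dual_ker0) /t linearZ.
exists x, ((2%:R / a k) *: y), ((2%:R / a k) *: k); split=> //.
- exact: in_root_spaceZ.
- by rewrite lieZr linearZ /= kE.
- by rewrite linearZ /= [_ *: _]mulfVK.
move=> c; rewrite /reflection !fE [c (_ *: _)]linearZ /=; congr (c - _); congr (_ *: a).
rewrite [RHS]/GRing.scale /=; field; by rewrite ak xy.
Qed.

(** From [v], go [r] steps up to the top of the string and then [n - r] steps down. Since
    [c k = n - 2r], this ends at the reflected weight. The condition [r <= n] keeps the natural
    subtraction honest. *)
Lemma root_string_reflection (a c : dual H) x y (k : subvs_of H) v :
  in_root_space b a x -> in_root_space b (- a) y -> b x y = vsval k ->
  a k = 2%:R -> in_root_space b c v -> v != 0 ->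
  exists r n : nat, c k = n%:R - (2 * r)%:R /\
    ((r <= n)%N -> exists2 w, w != 0 & in_root_space b (c - c k *: a) w).
Proof.
move=> hx hy xyk ak hv v0.
have n2 : (2%:R : K) != 0 by rewrite pnatr_eq0.
have [] := @sl2_string _ _ b x y (vsval k) (vsval k) 2%:R 2%:R (c k) (c k) v => //.
- by rewrite hx ak.
- by rewrite hy opp_lfunE ak.
- by rewrite hx ak.
- by rewrite hy opp_lfunE ak.
move=> r [n [ckE _ w0 Hw]]; exists r, n; split.
  by rewrite ckE natrM mulrBr mulrCA mulfV // mulr1.
move=> rn; exists (iter (n - r) (b y) (iter r (b x) v)); first by apply: Hw; exact: leq_subr.
have -> : c - c k *: a = c + a *+ r + (- a) *+ (n - r).
  rewrite ckE mulrBr mulrCA mulfV // mulr1 mulNrn.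
  rewrite -(scaler_nat r a) -(scaler_nat _ a) natrB // -!addrA.
  congr (c + _); rewrite -(scalerBl r%:R) -[LHS]scaleNr; congr (_ *: a); ring.
by apply: in_root_space_iter => //; exact: in_root_space_iter.
Qed.

Lemma reflection_roots (a c : dual H) : roots b H a -> roots b H c ->
  roots b H (reflection b a c).
Proof.
move=> ha [c0 [v v0 hv]]; have [x [y [k [hx hy xyk ak ->]]]] := root_sl2_triple ha.
split.
  rewrite subr_eq0; apply: contraNneq c0 => cE.
  have : c k = 0.
    have := congr1 (fun f : dual H => f k) cE; rewrite /= scale_lfunE ak [_ *: _]mulr_natr mulr2n.
    by move=> /eqP; rewrite -subr_eq0 opprD addrA subrr add0r oppr_eq0 => /eqP.
  by move=> ck; rewrite cE ck scale0r.
have [r [n [ckE]]] := root_string_reflection hx hy xyk ak hv v0.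
have [rn|rn _] := leqP r n; first exact.
(* When [n < r] the string is read with [x] and [y] exchanged. The two expressions for [c k] give
   [n + n' = 2r + 2r'], so [r' <= n']. *)
have hx' : in_root_space b (- - a) x by rewrite opprK.
have yxk : b y x = vsval (- k) by rewrite lieC xyk linearN.
have ak' : (- a) (- k) = 2%:R by rewrite opp_lfunE linearN opprK.
have [r' [n' [ckE']]] := root_string_reflection hy hx' yxk ak' hv v0.
rewrite [c (- k)]linearN /= scaleNr scalerN opprK; apply.
have /eqP : c k + c (- k) = 0 by rewrite linearN subrr.
rewrite ckE ckE' addrACA -opprD -!natrD subr_eq0 eqr_nat => /eqP; lia.
Qed.

(** Suppose [n >= 2] and let [w] be the top of the string, of weight [(n + r) a]. Lowering [w] to
    weight 0 lands in [H], whose bracket with [x] is a multiple of [x]. So the vector of weight [a]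
    in the string is proportional to [x] and is killed by [x], whereas [sl2_lowering] sends it to a
    nonzero vector. *)
Lemma root_multiple (a : dual H) n : roots b H a -> roots b H (a *+ n) -> n = 1%N.
Proof.
move=> ha [na0 [v v0 hv]]; have [x [y [k [hx hy xyk ak _]]]] := root_sl2_triple ha.
have n2 : (2%:R : K) != 0 by rewrite pnatr_eq0.
have [] := @sl2_string _ _ b x y (vsval k) (vsval k) 2%:R 2%:R ((a *+ n) k) ((a *+ n) k) v => //.
- by rewrite hx ak.
- by rewrite hy opp_lfunE ak.
- by rewrite hx ak.
- by rewrite hy opp_lfunE ak.
move=> r [m [akE xw w0 Hw]]; apply/eqP; rewrite -[_ == _]negbK; apply/negP => n1.
have n0 : n != 0%N by apply: contraNneq na0 => ->; rewrite mulr0n.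
have [j jE] : exists j, (n + r = j.+2)%N by exists (n + r - 2)%N; lia.
set w := iter r (b x) v in w0 xw Hw.
have mE : (m = (n + r) * 2)%N.
  move: akE; rewrite -(scaler_nat _ a) scale_lfunE ak [_ *: _]mulrC mulrBr mulrCA mulfV // mulr1.
  by move/eqP; rewrite -subr_eq0 opprB addrA -!natrM -natrD subr_eq0 eqr_nat => /eqP; lia.
have wt : in_root_space b (a *+ (n + r)) w by rewrite mulrnDr; exact: in_root_space_iter.
have kw : b (vsval k) w = (2%:R * (n + r)%:R) *: w.
  by rewrite wt -(scaler_nat _ a) scale_lfunE ak; congr (_ *: w); exact: mulrC.
have ky : b (vsval k) y = - 2%:R *: y by rewrite hy opp_lfunE ak.
have low i := sl2_lowering i xyk ky kw xw.
have coef i : (i <= n + r)%N -> (i.+1%:R * (2%:R * (n + r)%:R - 2%:R * i%:R / 2%:R) : K) != 0.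
  move=> ir; rewrite mulf_neq0 ?pnatr_eq0 // mulrAC mulfV // mul1r -natrM -natrB; last by lia.
  by rewrite pnatr_eq0; lia.
have hH' : iter j.+2 (b y) w \in H.
  apply: (weight0_in_cartan hH).
  rewrite (_ : 0 = a *+ (n + r) + (- a) *+ j.+2); first exact: in_root_space_iter.
  by rewrite -jE mulNrn subrr.
have := low j.+1; rewrite lieC -(vsprojK hH') hx -scaleNr => E.
have xu : b x (iter j.+1 (b y) w) = 0.
  have c0 := coef j.+1 (_ : (j.+1 <= n + r)%N).
  apply: (scalerI (c0 _)); first by rewrite jE.
  by rewrite scaler0 -lieZr -E lieZr lie_alt scaler0.
have := low j; rewrite xu => /esym/eqP; rewrite scaler_eq0 (negPf (coef _ _)) /=; last by lia.
by rewrite (negPf (Hw _ _)) //; lia.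
Qed.

End SimpleLie.

(** * Simple systems and products of orthogonal reflections *)

Section NatComb.
Variables (K : numFieldType) (g : vectType K) (H : {vspace g}).
Implicit Types (S P : seq (dual H)) (a c x y : dual H).

(** Coefficients indexed by the roots themselves, instead of by positions, survive permutation and
    concatenation of lists. *)
Lemma nat_combP S c : uniq S ->
  nat_comb S c <-> exists n : dual H -> nat, c = \sum_(x <- S) x *+ n x.
Proof.
move=> Su; split=> [[n ->]|[n ->]]; last first.
  by exists (fun i => n S`_i); rewrite (big_nth 0) big_mkord.
exists (fun x => if insub (index x S) is Some i then n i else 0%N).
rewrite (big_nth 0) big_mkord; apply: eq_bigr => i _.
by rewrite index_uniq // insubT //= => lt; congr (_ *+ n _); apply: val_inj.
Qed.

Lemma nat_comb_perm S S' c : uniq S -> perm_eq S S' -> nat_comb S c -> nat_comb S' c.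
Proof.
move=> Su SS' /(nat_combP c Su)[n ->].
apply/nat_combP; first by rewrite -(perm_uniq SS').
by exists n; rewrite (perm_big _ SS').
Qed.

Lemma simple_roots_perm (D : set (dual H)) S S' :
  perm_eq S S' -> simple_roots D S -> simple_roots D S'.
Proof.
move=> SS' [Sf SD Dn]; have Su := free_uniq Sf; split.
- by rewrite -(perm_free SS').
- by move=> a; rewrite -(perm_mem SS'); exact: SD.
- by move=> a /Dn[]h; [left|right]; exact: nat_comb_perm h.
Qed.

Lemma dual_basis S x : free S -> x \in S ->
  exists f : 'Hom(dual H, K^o), f x = 1 /\ forall y, y \in S -> y != x -> f y = 0.
Proof.
move=> Sf xS; have Su := free_uniq Sf.
have lt : (index x S < size S)%N by rewrite index_mem.
pose i := Ordinal lt; pose f := coord (in_tuple S) i.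
exists (linfun (f : dual H -> K^o)); split=> [|y yS yx].
  have := @coord_free _ _ _ (in_tuple S) i i Sf; rewrite eqxx /= nth_index // => E.
  by rewrite lfunE.
have lty : (index y S < size S)%N by rewrite index_mem.
have := @coord_free _ _ _ (in_tuple S) (Ordinal lty) i Sf; rewrite /= nth_index // => E.
rewrite lfunE /= E -val_eqE /=; suff /negPf-> : index y S != index x S by [].
by apply: contraNneq yx => E'; rewrite -(nth_index 0 yS) -(nth_index 0 xS) E'.
Qed.

Lemma dual_basis_sum S x (f : 'Hom(dual H, K^o)) (n : dual H -> nat) :
  uniq S -> x \in S -> f x = 1 -> (forall y, y \in S -> y != x -> f y = 0) ->
  f (\sum_(y <- S) y *+ n y) = (n x)%:R.
Proof.
move=> Su xS fx fy; rewrite linear_sum (bigD1_seq x) //= big_seq_cond big1.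
  by rewrite addr0 linearMn /= fx.
by move=> y /andP[yS yx]; rewrite linearMn /= fy // mul0rn.
Qed.

Lemma span_functional0 P (f : 'Hom(dual H, K^o)) v :
  (forall y, y \in P -> f y = 0) -> v \in <<P>>%VS -> f v = 0.
Proof.
move=> fP /(@coord_span _ _ _ (in_tuple P)) ->; rewrite linear_sum big1 // => i _.
by rewrite linearZ /= fP ?scaler0 // mem_nth.
Qed.

End NatComb.

Section SimpleReflections.
Variables (K : numFieldType) (g : vectType K) (b : lieBracket g).
Hypothesis hsimple : lie_simple b.
Variable H : {vspace g}.
Hypothesis hH : cartan_subalgebra b H.
Local Notation D := (roots b H).
Implicit Types (S P : seq (dual H)) (a c x y : dual H).

Lemma reflection_linear a : D a -> linear (reflection b a).
Proof.
move=> /(root_sl2_triple hsimple hH)[x [y [k [_ _ _ _ rE]]]] t u v.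
rewrite !rE add_lfunE scale_lfunE scalerDl scalerBr opprD addrACA.
by rewrite -[(_ *: u k) *: a]scalerA.
Qed.

Lemma reflection_self a : D a -> reflection b a a = - a.
Proof.
move=> /(root_sl2_triple hsimple hH)[x [y [k [_ _ _ ak rE]]]].
by rewrite rE ak scaler_nat mulr2n opprD addrA subrr add0r.
Qed.

Lemma reflection_orthogonal a c : dual_form b c a = 0 -> reflection b a c = c.
Proof. by move=> E; rewrite /reflection E mulr0 mul0r scale0r subr0. Qed.

Variable P : seq (dual H).
Hypothesis PD : forall a, a \in P -> D a.

Lemma prod_reflections_linear : linear (prod_reflections b P).
Proof.
move=> t u v; elim: P PD => [|a s IH] sD //=.
rewrite IH => [|c cs]; last by apply: sD; rewrite in_cons cs orbT.
by apply: reflection_linear; apply: sD; rewrite mem_head.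
Qed.

Lemma prod_reflections_roots c : D c -> D (prod_reflections b P c).
Proof.
move=> Dc; elim: P PD => [|a s IH] sD //=.
apply: (reflection_roots hsimple hH); first by apply: sD; rewrite mem_head.
by apply: IH => x xs; apply: sD; rewrite in_cons xs orbT.
Qed.

Lemma prod_reflections_span c : prod_reflections b P c - c \in <<P>>%VS.
Proof.
clear PD; elim: P => [|a s IH] /=; first by rewrite subrr mem0v.
rewrite /reflection addrAC span_cons addrC memv_add ?IH //.
by rewrite -scaleNr memvZ // memv_line.
Qed.

Hypothesis Pu : uniq P.
Hypothesis Porth : mutually_orthogonal b P.

Lemma prod_reflections_simple a : a \in P -> prod_reflections b P a = - a.
Proof.
move=> aP; have H1 s : {subset s <= P} -> uniq s ->
    prod_reflections b s a = if a \in s then - a else a.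
  elim: s => [|c s IH] //= sP /andP[cs su].
  have cP : c \in P by apply: sP; rewrite mem_head.
  rewrite IH // => [|x xs]; last by apply: sP; rewrite in_cons xs orbT.
  rewrite in_cons; have [->|ac] := eqVneq a c.
    by rewrite (negPf cs) /= reflection_self //; apply: PD.
  have E : reflection b c a = a by apply: reflection_orthogonal; exact: Porth.
  case: ifP => // _; have := reflection_linear (PD cP) (-1) a 0.
  rewrite !addr0 !scaleN1r => ->.
  by rewrite E -[reflection b c 0](_ : 0 = _) ?addr0 //
      /reflection /dual_form lfunE /= mulr0 mul0r scale0r subr0.
by rewrite H1 // aP.
Qed.

Lemma prod_reflections_additive : {morph prod_reflections b P : u v / u + v}.
Proof.
by move=> u v; have := prod_reflections_linear 1 u v; rewrite !scale1r.
Qed.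

Lemma prod_reflections_on_span v : v \in <<P>>%VS -> prod_reflections b P v = - v.
Proof.
have L := linfun_linearE prod_reflections_linear.
move=> /(@coord_span _ _ _ (in_tuple P)) ->; rewrite -L linear_sum -sumrN.
apply: eq_bigr => i _; rewrite linearZ /= L prod_reflections_simple ?mem_nth //.
by rewrite scalerN.
Qed.

(** The product moves [c] by an element of the span of [P], and on that span it is -1. *)
Lemma prod_reflections_involutive : involutive (prod_reflections b P).
Proof.
move=> c; have cP := prod_reflections_span c.
rewrite -[in LHS](subrK c (prod_reflections b P c)) prod_reflections_additive.
by rewrite prod_reflections_on_span // opprB subrK.
Qed.

End SimpleReflections.

Section SimpleSystem.
Variables (K : numFieldType) (g : vectType K) (b : lieBracket g).
Hypothesis hsimple : lie_simple b.
Variable H : {vspace g}.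
Hypothesis hH : cartan_subalgebra b H.
Local Notation D := (roots b H).
Implicit Types (S P : seq (dual H)) (a c x y : dual H).

Lemma nat_comb_opp S c : free S -> nat_comb S c -> nat_comb S (- c) -> c = 0.
Proof.
move=> Sf; have Su := free_uniq Sf.
move=> /(nat_combP c Su)[n cn] /(nat_combP (- c) Su)[m cm].
rewrite cn big_seq big1 // => x xS; have [f [fx fy]] := dual_basis Sf xS.
have := congr1 f cm; rewrite linearN /= cn !(dual_basis_sum _ Su xS fx fy).
move=> /eqP; rewrite eq_sym -addr_eq0 -natrD pnatr_eq0 addn_eq0 => /andP[_ /eqP ->].
exact: mulr0n.
Qed.

Variables P Q : seq (dual H).
Hypothesis hPQ : simple_roots D (P ++ Q).
Hypothesis Porth : mutually_orthogonal b P.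

Let Sf : free (P ++ Q). Proof. by case: hPQ. Qed.
Let Su : uniq (P ++ Q). Proof. exact: free_uniq. Qed.
Let Pu : uniq P. Proof. by move: Su; rewrite cat_uniq => /andP[]. Qed.
Let PD a : a \in P -> D a.
Proof. by move=> aP; have [_ SD _] := hPQ; apply: SD; rewrite mem_cat aP. Qed.
Let PS a : a \in P -> a \in P ++ Q. Proof. by rewrite mem_cat => ->. Qed.

(** Reflecting in some [x] with [n x != 0] flips the sign of that one coefficient. Roots have
    coefficients of a single sign, so all the others vanish, and [root_multiple] leaves [c = x]. *)
Lemma root_in_orthogonal_span c (n : dual H -> nat) :
  D c -> c = \sum_(y <- P) y *+ n y -> c \in P.
Proof.
move=> Dc cn.
have Pf : free P by exact: catl_free Sf.
have [x xP nx] : exists2 x, x \in P & n x != 0%N.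
  apply: contrapT => nex; have [/eqP c0 _] := Dc; apply: c0.
  rewrite cn big_seq big1 // => y yP; have [->|ny] := eqVneq (n y) 0%N; first exact: mulr0n.
  by case: nex; exists y.
pose r := reflection b x.
have L := linfun_linearE (reflection_linear hsimple hH (PD xP)).
have csplit : c = x *+ n x + \sum_(y <- P | y != x) y *+ n y.
  by rewrite cn (bigD1_seq x).
have rc : r c = c - x *+ (n x).*2.
  rewrite /r -L {1}csplit linearD linear_sum linearMn /= L.
  rewrite (reflection_self hsimple hH (PD xP)).
  rewrite (_ : \sum_(_ <- _ | _) _ = c - x *+ n x); last first.
    rewrite {1}csplit addrAC subrr add0r big_seq_cond [RHS]big_seq_cond.
    apply: eq_bigr => y /andP[yP yx].
    by rewrite linearMn /= L reflection_orthogonal // Porth.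
  by rewrite mulNrn addrC -addrA -opprD -mulrnDr addnn.
have Drc : D (r c) by apply: (reflection_roots hsimple hH) => //; exact: PD.
have [_ _ /(_ _ Drc)[] /(nat_combP _ Su)[m rcm]] := hPQ.
  have [f [fx fy]] := dual_basis Sf (PS xP).
  have fyP y : y \in P -> y != x -> f y = 0 by move=> /PS; exact: fy.
  have := congr1 f rcm; rewrite (dual_basis_sum _ Su (PS xP) fx fy) rc.
  rewrite linearB linearMn /= fx cn (dual_basis_sum _ Pu xP fx fyP) => /eqP.
  rewrite subr_eq -natrD eqr_nat => /eqP; lia.
have ny0 y : y \in P -> y != x -> n y = 0%N.
  move=> yP yx; have [f [fx fy]] := dual_basis Sf (PS yP).
  have fyP z : z \in P -> z != y -> f z = 0 by move=> /PS; exact: fy.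
  have := congr1 f rcm; rewrite (dual_basis_sum _ Su (PS yP) fx fy) rc.
  rewrite linearN linearB linearMn /= (fyP x) 1?eq_sym // mul0rn subr0.
  rewrite cn (dual_basis_sum _ Pu yP fx fyP) => /eqP.
  by rewrite eq_sym -addr_eq0 -natrD pnatr_eq0 addn_eq0 => /andP[_ /eqP].
have cx : c = x *+ n x.
  rewrite {1}csplit big_seq_cond big1 ?addr0 // => y /andP[yP yx].
  by rewrite ny0 // mulr0n.
have := Dc; rewrite cx => /(root_multiple hsimple hH (PD xP)) ->.
by rewrite mulr1n.
Qed.

(** The coefficients on [Q] do not change. If the image were negative they would all be zero, so [c]
    would be a root in the span of [P], hence a member of [P]. *)
Lemma prod_reflections_positive c :
  D c -> nat_comb (P ++ Q) c -> c \notin P -> nat_comb (P ++ Q) (prod_reflections b P c).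
Proof.
move=> Dc /(nat_combP _ Su)[n cn] cP.
have Dtc := prod_reflections_roots hsimple hH PD Dc.
have [_ _ /(_ _ Dtc)[//|/(nat_combP _ Su)[m tcm]]] := hPQ.
have nQ x : x \in Q -> n x = 0%N.
  move=> xQ; have xS : x \in P ++ Q by rewrite mem_cat xQ orbT.
  have [f [fx fy]] := dual_basis Sf xS.
  have xP : x \notin P.
    by move: Su; rewrite cat_uniq => /and3P[_ /hasPn/(_ x xQ)].
  have f0 : f (prod_reflections b P c - c) = 0.
    apply: (span_functional0 (P := P)) (prod_reflections_span b P c) => y yP.
    by apply: fy; [exact: PS|apply: contraNneq xP => <-].
  have := congr1 f tcm; rewrite (dual_basis_sum _ Su xS fx fy).
  rewrite -[prod_reflections b P c](subrK c) linearN linearD /= f0 add0r.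
  rewrite [in f c]cn (dual_basis_sum _ Su xS fx fy) => /eqP.
  by rewrite eq_sym -addr_eq0 -natrD pnatr_eq0 addn_eq0 => /andP[_ /eqP].
exfalso; move/negP: cP; apply; apply: (@root_in_orthogonal_span c n Dc).
rewrite {1}cn big_cat /= [X in _ + X]big_seq [X in _ + X]big1 ?addr0 // => x /nQ ->.
exact: mulr0n.
Qed.

End SimpleSystem.

(** * Extreme rays of the cone of positive roots *)

Section ExtremeRoots.
Variables (K : numFieldType) (g : vectType K) (b : lieBracket g).
Hypothesis hsimple : lie_simple b.
Variable H : {vspace g}.
Hypothesis hH : cartan_subalgebra b H.
Local Notation D := (roots b H).
Variables P Q : seq (dual H).
Hypothesis hPQ : simple_roots D (P ++ Q).
Hypothesis Porth : mutually_orthogonal b P.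
Hypothesis Qorth : mutually_orthogonal b Q.

Lemma prod_reflections_positiver c :
  D c -> nat_comb (P ++ Q) c -> c \notin Q -> nat_comb (P ++ Q) (prod_reflections b Q c).
Proof.
move=> Dc cpos cQ; have Su : uniq (P ++ Q) by case: hPQ => /free_uniq.
have QP : simple_roots D (Q ++ P) by apply: simple_roots_perm hPQ; rewrite perm_catC.
apply: (@nat_comb_perm _ _ _ (Q ++ P)); [by rewrite uniq_catC | by rewrite perm_catC |].
apply: (prod_reflections_positive hsimple hH QP Qorth) => //.
by apply: nat_comb_perm cpos => //; rewrite perm_catC.
Qed.

(* X is an extreme ray of the cone of positive roots, cut out by the functional
   phi: a simple root occurring in an element of X again lies on X. *)
Lemma extreme_roots_simple (W : realDomainType) (phi : dual H -> W) (X : set (dual H)) :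
  {morph phi : u v / u + v} ->
  (forall c, D c -> nat_comb (P ++ Q) c -> phi c <= 0 /\ (phi c = 0 <-> X c)) ->
  (forall c, X c -> [/\ D c, nat_comb (P ++ Q) c,
     ~ nat_comb (P ++ Q) (prod_reflections b P (prod_reflections b Q c)) &
     prod_reflections b P (prod_reflections b Q c) <> - c]) ->
  X `<=` [set` Q].
Proof.
move=> phiD phiX XP c Xc; have [Sf SD Dn] := hPQ; have Su := free_uniq Sf.
have PD a : a \in P -> D a by move=> aP; apply: SD; rewrite mem_cat aP.
have QD a : a \in Q -> D a by move=> aQ; apply: SD; rewrite mem_cat aQ orbT.
have [Pu PQ Qu] : [/\ uniq P, forall a, a \in P -> a \notin Q & uniq Q].
  move: Su; rewrite cat_uniq => /and3P[-> /hasPn dis ->]; split=> // a aP.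
  by apply/negP => /dis; rewrite /= aP.
(* The reflections in [Q] keep such a root positive, so only those in [P] can make it negative, and
   they do so only on members of [P]. *)
have step a : X a -> a \notin Q -> prod_reflections b Q a \in P.
  move=> /XP[Da apos aneg _] aQ; apply/negPn/negP => taP; apply: aneg.
  apply: (prod_reflections_positive hsimple hH hPQ Porth) => //.
    exact: (prod_reflections_roots hsimple hH QD).
  exact: prod_reflections_positiver.
apply/negPn/negP => cQ; have tP := step c Xc cQ.
set p := prod_reflections b Q c in tP.
have cE : c = prod_reflections b Q p.
  by rewrite (prod_reflections_involutive hsimple hH QD Qu Qorth).
have pS : p \in P ++ Q by rewrite mem_cat tP.
(* [f] is the coefficient of [p]. The reflections in [Q] alter only coefficients on [Q], so [p]
   occurs in [c] with coefficient 1. *)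
have [f [fp fy]] := dual_basis Sf pS.
have fc : f c = 1.
  have f0 : f (prod_reflections b Q p - p) = 0.
    apply: (span_functional0 (P := Q)) (prod_reflections_span b Q p) => y yQ.
    apply: fy; first by rewrite mem_cat yQ orbT.
    by apply: contraTneq yQ => ->; exact: PQ.
  by rewrite cE -[prod_reflections b Q p](subrK p) linearD /= f0 add0r.
have [Dc cpos _ _] := XP c Xc.
(* [phi] is nonpositive on simple roots and zero on [c], so it vanishes on every simple root
   occurring in [c]. *)
have Xp : X p.
  have [n cn] := (nat_combP c Su).1 cpos.
  have np : n p != 0%N.
    have := fc; rewrite cn (dual_basis_sum _ Su pS fp fy) => /eqP.
    by rewrite -[1]/(1%:R) eqr_nat => /eqP ->.
  have phi0 : phi 0 = 0 by apply: (addrI (phi 0)); rewrite -phiD !addr0.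
  have phiMn u k : phi (u *+ k) = phi u *+ k.
    by elim: k => [|k IH]; rewrite ?mulr0n // !mulrS phiD IH.
  have nat1 x : x \in P ++ Q -> nat_comb (P ++ Q) x.
    move=> xS; apply/(nat_combP _ Su); exists (fun y => (y == x) : nat).
    rewrite (bigD1_seq x) //= eqxx mulr1n big1 ?addr0 // => y /negPf ->.
    exact: mulr0n.
  have phi_le x : x \in P ++ Q -> phi x <= 0.
    by move=> xS; have [] := phiX x (SD _ xS) (nat1 _ xS).
  have [_ [pX _]] := phiX p (SD _ pS) (nat1 _ pS); apply: pX.
  have [_ [_ /(_ Xc)]] := phiX c Dc cpos.
  rewrite cn (big_morph phi phiD phi0) (bigD1_seq p) //= => /eqP.
  have rest : \sum_(i <- P ++ Q | i != p) phi (i *+ n i) <= 0.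
    rewrite big_seq_cond; apply: sumr_le0 => i /andP[iS _].
    by rewrite phiMn mulrn_wle0 // phi_le.
  have := phi_le p pS; rewrite le_eqVlt => /predU1P[//|plt].
  have : phi (p *+ n p) < 0 by rewrite phiMn pmulrn_llt0 // lt0n.
  by move=> lt; rewrite lt_eqF // ltr_wnDr.
(* Now [step] applies to [p] itself. Thus [c] is a simple root containing [p], so [c = p], and the
   product of reflections sends [c] to [- c], which is excluded. *)
have cP : c \in P by rewrite cE; apply: step => //; exact: PQ.
have pc : p = c.
  apply/eqP; rewrite -[_ == _]negbK; apply/negP => pc.
  have := fc; rewrite fy ?mem_cat ?cP // 1?eq_sym // => /eqP.
  by rewrite eq_sym oner_eq0.
have [_ _ _] := XP c Xc; apply; rewrite -/p -pc.
exact: (prod_reflections_simple hsimple hH PD Pu Porth).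
Qed.

End ExtremeRoots.

(** The difference of [psi] and the simple root number [i] has natural coefficients, one of which is
    [q i - 1]. *)
Lemma highest_root_coef_gt0 (K : numFieldType) (g : vectType K) (H : {vspace g})
    (D : set (dual H)) l (alpha : l.-tuple (dual H)) psi (q : 'I_l -> nat) :
  simple_roots D alpha -> highest_root D alpha psi ->
  psi = \sum_(i < l) tnth alpha i *+ q i -> forall i, (0 < q i)%N.
Proof.
move=> [af aD _] [_ hi] psiE i; have au := free_uniq af.
have ai : tnth alpha i \in (alpha : seq _) by exact: mem_tnth.
have [n nE] := (nat_combP _ au).1 (hi _ (aD _ ai)).
have [f [f1 f0]] := dual_basis af ai.
have := congr1 f nE; rewrite (dual_basis_sum _ au ai f1 f0) linearB /= f1.
have -> : f psi = (q i)%:R :> K.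
  rewrite psiE linear_sum (bigD1 i) //= linearMn /= f1 big1 ?addr0 // => j ji.
  rewrite linearMn /= f0 ?mul0rn ?mem_tnth //.
  by rewrite (inj_eq (tuple_uniqP _ au)).
move=> /eqP; rewrite subr_eq natr1 eqr_nat => /eqP ->; exact: ltn0Sn.
Qed.

(** * Clockwise labellings *)

Section Expi.
Variable R : realType.
Implicit Types (s t r : R) (z w : R[i]).

Lemma expi0 : expi 0 = 1 :> R[i].
Proof. by rewrite /expi cos0 sin0. Qed.

Lemma expiD s t : expi (s + t) = expi s * expi t.
Proof. by rewrite /expi cosD sinD; simpc; congr (_ +i* _); rewrite addrC. Qed.

Lemma expiNM s : expi s * expi (- s) = 1.
Proof. by rewrite -expiD subrr expi0. Qed.

Lemma expi_pi : expi pi = -1 :> R[i].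
Proof. by rewrite /expi cospi sinpi; apply/eqP; rewrite eq_complex /= oppr0 !eqxx. Qed.

Lemma expi_2pi : expi (2%:R * pi) = 1 :> R[i].
Proof. by rewrite mulr_natl mulr2n expiD expi_pi mulrNN mulr1. Qed.

Lemma norm_expi t : `|expi t| = 1.
Proof. by rewrite normc_def /= cos2Dsin2 sqrtr1. Qed.

Lemma expi_neq0 t : expi t != 0.
Proof. by rewrite -normr_eq0 norm_expi oner_eq0. Qed.

(** For [u = s - t], the equation [cos u = 1] gives [sin (u / 2) = 0], and the half angle lies
    strictly between [- pi] and [pi]. *)
Lemma expi_inj s t : expi s = expi t -> `|s - t| < 2%:R * pi -> s = t.
Proof.
move=> E lt; apply/eqP; rewrite -subr_eq0; set u := s - t in lt *.
have : expi u = 1 by rewrite expiD E expiNM.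
move=> /eqP; rewrite eq_complex /= => /andP[/eqP cu _].
have su : sin (u / 2%:R) = 0.
  have : cos (u / 2%:R + u / 2%:R) = 1 by rewrite -splitr.
  rewrite cosD -!expr2 => H; have := cos2Dsin2 (u / 2%:R).
  by move=> H2; apply/eqP; rewrite -sqrf_eq0; apply/eqP; lra.
have [u0|u0|//] := ltgtP u 0.
- have := @sin_gt0_pi R (- (u / 2%:R)); rewrite sinN su oppr0 ltxx => /(_ _)/negP.
  have pi0 := pi_gt0 R.
  by case; rewrite ltr0_norm // in lt; apply/andP; split; lra.
- have := @sin_gt0_pi R (u / 2%:R); rewrite su ltxx => /(_ _)/negP.
  by case; rewrite gtr0_norm // in lt; apply/andP; split; lra.
Qed.

Lemma ray_expi_inj s t w : w != 0 -> ray (expi s) w -> ray (expi t) w -> expi s = expi t.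
Proof.
move=> w0 [r r0 wr] [r' r0' wr'].
have N (q p : R) : 0 <= q -> w = q%:C * expi p -> `|w| = q%:C.
  by move=> q0 ->; rewrite normrM norm_expi mulr1 ger0_norm // ler0c.
have E : r%:C = r'%:C :> R[i] by rewrite -(N r s) // (N r' t).
have r'0 : r'%:C != 0 :> R[i] by apply: contraNneq w0 => z0; rewrite wr' z0 mul0r.
by apply: (mulfI r'0); rewrite -wr' wr E.
Qed.

Lemma ray_mul z w t : ray z w -> ray (z * expi t) (w * expi t).
Proof. by move=> [r r0 ->]; exists r => //; rewrite mulrA. Qed.

End Expi.

(* A translation of a discrete decreasing set of angles into itself preserves
   the order, so on the enumeration of the set it is a shift of the index. *)
Lemma decreasing_shift (R : realType) (th : nat -> R) (N n : nat) (T c : R) :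
  (forall i j, (i < j)%N -> th j < th i) ->
  (forall i, th (i + N)%N = th i - T) ->
  (0 < n)%N -> n%:R * c = T -> (forall i, exists j, th j = th i - c) ->
  exists m, (n * m)%N = N /\ forall i, th (i + m)%N = th i - c.
Proof.
move=> thd thN n0 nc /choice[f fE].
have thinj i j : th i = th j -> i = j.
  move=> E; have [lt|lt|//] := ltngtP i j; have := thd _ _ lt; rewrite E ltxx //.
have thlt i j : th i < th j -> (j < i)%N.
  move=> lt; rewrite ltnNge; apply/negP => le; have := lt.
  by move: le; rewrite leq_eqVlt => /predU1P[->|/thd];
    rewrite ?ltxx // => /lt_trans/[apply]; rewrite ltxx.
have iterE k i : th (iter k f i) = th i - k%:R * c.
  elim: k => [|k IH]; first by rewrite mul0r subr0.
  by rewrite iterS fE IH -natr1 mulrDl mul1r opprD addrA.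
have fS i : f i.+1 = (f i).+1.
  apply/eqP; rewrite eqn_leq; apply/andP; split; last first.
    by apply: thlt; rewrite !fE ltrD2r; exact: thd.
  rewrite leqNgt; apply/negP => lt.
  have h1 := thd _ _ lt; have h2 := thd _ _ (ltnSn (f i)).
  rewrite fE in h1; rewrite fE in h2.
  (* If [f] skipped an index, [n - 1] further applications would complete a drop by [T] and place
     [j] strictly between the consecutive indices [i + N] and [i.+1 + N]. *)
  pose j := iter n.-1 f (f i).+1.
  have jE : th j = th (f i).+1 + c - T.
    by rewrite iterE -nc -[in RHS](prednK n0) -natr1 mulrDl mul1r; ring.
  have : (i + N < j)%N by apply: thlt; rewrite jE thN; lra.
  have : (j < i.+1 + N)%N by apply: thlt; rewrite jE thN; lra.
  by lia.
have fE' i : f i = (i + f 0)%N by elim: i => // i IH; rewrite fS IH.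
have shift i : th (i + f 0)%N = th i - c by rewrite -fE' fE.
exists (f 0); split=> //.
have iterf k : iter k f 0 = (k * f 0)%N.
  by elim: k => // k IH; rewrite iterS IH fE' mulSn addnC.
by apply: thinj; rewrite -iterf iterE nc -[N]add0n thN.
Qed.

Section Labelling.
Variables (R : realType) (A : Type) (D : set A) (z : A -> R[i]).
Hypothesis z0 : forall a, D a -> z a != 0.
Variables (N : nat) (d : nat -> set R[i]).
Hypothesis N0 : (0 < N)%N.
Hypothesis hd : clockwise_labelling [set ray (z a) | a in D] N d.

Lemma expi_sub2pi (t : R) k : expi (t - 2%:R * pi * k%:R) = expi t.
Proof.
elim: k => [|k IH]; first by rewrite mulr0 subr0.
rewrite -[in RHS]IH -(natr1 k) mulrDr mulr1 opprD addrA.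
by rewrite -[X in _ = expi X](subrK (2%:R * pi)) [in RHS]expiD expi_2pi mulr1.
Qed.

(* The angles of d 1, ..., d N, indexed from 0 and continued over all turns. *)
Lemma labelling_angles : exists th : nat -> R,
  [/\ forall i j, (i < j)%N -> th j < th i,
      forall i, th (i + N)%N = th i - 2%:R * pi,
      forall i, (i < N)%N -> d i.+1 = ray (expi (th i)),
      forall i, exists2 a, D a & ray (expi (th i)) (z a) &
      forall a, D a -> exists2 i, (i < N)%N & ray (expi (th i)) (z a)].
Proof.
have [[theta [dE thd thN]] SE] := hd.
have pi0 := pi_gt0 R.
(* The quotient by [N] counts full turns and the remainder is the place within a turn; the successor
   appears because the labels start at 1. Across the end of a turn the order comes from [thN]. *)
pose th i := theta (i %% N).+1 - 2%:R * pi * (i %/ N)%:R.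
have thN' i : th (i + N)%N = th i - 2%:R * pi.
  by rewrite /th modnDr divnDr // divnn N0 natrD mulrDr mulr1 opprD addrA.
have thS i : th i.+1 < th i.
  have mN : (i %% N < N)%N by rewrite ltn_mod.
  have iE := divn_eq i N; have [lt|le] := ltnP (i %% N).+1 N.
    have E : i.+1 = (i %/ N * N + (i %% N).+1)%N by lia.
    rewrite /th E modnMDl (modn_small lt) divnMDl // (divn_small lt) addn0.
    by rewrite ltrD2r; apply: thd => //; rewrite ltnSn.
  have EN : (i %% N).+1 = N by apply/eqP; rewrite eqn_leq mN le.
  have E : i.+1 = ((i %/ N).+1 * N + 0)%N by lia.
  rewrite /th E modnMDl mod0n divnMDl // div0n addn0 EN -(natr1 (i %/ N)); lra.
have dE' i : (i < N)%N -> d i.+1 = ray (expi (th i)).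
  by move=> lt; rewrite dE // /th modn_small // divn_small // mulr0 subr0.
have self w : ray w w by exists 1; rewrite ?ler01 ?mul1r.
exists th; split=> // [i j|i|a Da].
- elim: j => // j IH; rewrite ltnS leq_eqVlt => /predU1P[->//|/IH].
  exact: lt_trans.
- have mN : (i %% N < N)%N by rewrite ltn_mod.
  have : [set ray (z a) | a in D] (d (i %% N).+1).
    by rewrite SE; exists (i %% N).+1.
  move=> [a Da aE]; exists a => //.
  by rewrite /th expi_sub2pi -dE // -aE.
- have : [set ray (z a) | a in D] (ray (z a)) by exists a.
  rewrite SE => -[i /andP[i1 iN] dz]; exists i.-1; first by rewrite prednK.
  by rewrite -dE' ?prednK // dz.
Qed.

Variable th : nat -> R.
Hypothesis thd : forall i j, (i < j)%N -> th j < th i.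
Hypothesis thN : forall i, th (i + N)%N = th i - 2%:R * pi.
Hypothesis th_root : forall i, exists2 a, D a & ray (expi (th i)) (z a).
Hypothesis root_th : forall a, D a -> exists2 i, (i < N)%N & ray (expi (th i)) (z a).

Lemma angle_mul i k : th (i + k * N)%N = th i - 2%:R * pi * k%:R.
Proof.
elim: k => [|k IH]; first by rewrite addn0 mulr0 subr0.
by rewrite (_ : i + k.+1 * N = i + k * N + N)%N ?thN ?IH -?(natr1 k); [ring|lia].
Qed.

Lemma angle_unique a i j : D a -> ray (expi (th i)) (z a) -> ray (expi (th j)) (z a) ->
  i = j %[mod N].
Proof.
move=> Da ai aj; have E := ray_expi_inj (z0 Da) ai aj.
have red k : expi (th k) = expi (th (k %% N)).
  by rewrite {1}(divn_eq k N) addnC angle_mul expi_sub2pi.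
have close k l : (k < l < N)%N -> expi (th k) = expi (th l) -> False.
  move=> /andP[kl lN] /expi_inj H.
  have h1 := thd kl; have h2 : th (k + N)%N < th l by apply: thd; lia.
  rewrite thN in h2.
  have kE : th k = th l by apply: H; rewrite gtr0_norm; lra.
  by rewrite kE ltxx in h1.
rewrite red [in RHS]red in E.
have [lt|lt|//] := ltngtP (i %% N) (j %% N).
- by case: (close _ _ _ E); rewrite lt ltn_mod.
- by case: (close _ _ _ (esym E)); rewrite lt ltn_mod.
Qed.

(** The set of angles is stable under subtracting [c], so [decreasing_shift] applies. With
    [N = 2 * s], the case [n = s] gives the shift by 2 of the Coxeter element, and [n = 2] gives the
    shift by [s] of negation. *)
Lemma angle_shift (f : A -> A) n (c : R) : (0 < n)%N -> n%:R * c = 2%:R * pi ->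
  (forall a, D a -> D (f a)) -> (forall a, D a -> z (f a) = z a * expi (- c)) ->
  exists m, [/\ (n * m)%N = N, forall i, th (i + m)%N = th i - c &
    forall a i, D a -> ray (expi (th i)) (z a) -> ray (expi (th (i + m)%N)) (z (f a))].
Proof.
move=> n0 nc fD fz; have pi0 := pi_gt0 R.
have c0 : 0 < c.
  have : 0 < n%:R * c by rewrite nc mulr_gt0.
  by rewrite pmulr_rgt0 // ltr0n.
have [i|m [nm mE]] := decreasing_shift thd thN n0 nc.
  have [a Da ai] := th_root i; have [j jN aj] := root_th (fD a Da).
  have aj' : ray (expi (th i - c)) (z (f a)).
    by rewrite fz // expiD; exact: ray_mul.
  have E := ray_expi_inj (z0 (fD _ Da)) aj aj'.
  have lo : - (2%:R * pi) < th j - (th i - c).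
    have : th N < th j by exact: thd.
    rewrite -[N]add0n thN; have : th i <= th 0.
      by case: i {ai aj' E} => // i; apply/ltW/thd.
    lra.
  (* The index [j] lies in the first turn, so lowering its angle by [k] full turns brings it within
     one turn of [th i - c]; equality of [expi] then gives equality of angles. *)
  have [k /andP[k1 k2]] : exists k : nat,
      - (2%:R * pi) < th j - (th i - c) - 2%:R * pi * k%:R < 2%:R * pi.
    set x := th j - _ in lo *; have [x0|x0] := ltP x 0.
      by exists 0; rewrite mulr0 subr0 lo /=; lra.
    have p2 : 0 < 2%:R * pi :> R by rewrite mulr_gt0.
    exists (Num.truncn (x / (2%:R * pi))).
    have /truncn_itv/andP[] : 0 <= x / (2%:R * pi) by rewrite divr_ge0 // ltW.
    by rewrite ler_pdivlMr // ltr_pdivrMr // -(natr1 (Num.truncn _)) => h1 h2;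
      apply/andP; split; lra.
  exists (j + k * N)%N; rewrite angle_mul; apply: expi_inj.
    by rewrite expi_sub2pi.
  by rewrite ltr_norml addrAC; apply/andP.
exists m; split=> // a i Da ai.
by rewrite mE fz // expiD; exact: ray_mul.
Qed.

Lemma root_angle_mod a i : D a -> ray (expi (th i)) (z a) ->
  ray (expi (th (i %% N))) (z a).
Proof.
move=> Da ai; have [j jN aj] := root_th Da.
by rewrite (angle_unique Da ai aj) modn_small.
Qed.

End Labelling.

Lemma modn_cases N i j : (i < N)%N -> (j < 2 * N)%N -> j = i %[mod N] ->
  j = i \/ j = (i + N)%N.
Proof.
move=> iN jN; rewrite (modn_small iN) => ji; have := divn_eq j N; rewrite ji.
have : (j %/ N < 2)%N by rewrite ltn_divLR //; lia.
by case: (j %/ N)%N => [|[|//]] _ ->; [left|right]; lia.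
Qed.

(** The imaginary part after rotation by [- u] is an additive functional vanishing on the ray of
    angle [u]; its sign tells on which side [w] lies. It serves as [phi] in
    [extreme_roots_simple]. *)
Lemma Im_ray (R : realType) (t u : R) (w : R[i]) : w != 0 -> ray (expi t) w ->
  exists2 r, 0 < r & complex.Im (w * expi (- u)) = r * sin (t - u).
Proof.
move=> w0 [r r0 wE]; exists r.
  by rewrite lt_neqAle r0 andbT; apply: contraNneq w0 => r0'; rewrite wE -r0' mul0r.
by rewrite wE -mulrA -expiD /expi; simpc.
Qed.

Section HalfTurn.
Variables (R : realType) (th : nat -> R) (s : nat).
Hypothesis thd : forall i j, (i < j)%N -> th j < th i.
Hypothesis ths : th s = th 0%N - pi.

Lemma first_ray_extreme i (w : R[i]) : w != 0 -> (i < s)%N -> ray (expi (th i)) w ->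
  complex.Im (w * expi (- th 0%N)) <= 0 /\ (complex.Im (w * expi (- th 0%N)) = 0 <-> i = 0%N).
Proof.
move=> w0 iS wi; have [r r0 ->] := Im_ray (th 0%N) w0 wi.
case: i iS {wi} => [_|i iS]; first by rewrite subrr sin0 mulr0.
have h1 := thd (ltn0Sn i); have h2 := thd iS; rewrite ths in h2.
have sn : 0 < sin (th 0%N - th i.+1).
  by apply: sin_gt0_pi; apply/andP; split; [rewrite subr_gt0|rewrite ltrBlDr -ltrBlDl].
have neg : r * sin (th i.+1 - th 0%N) < 0 by rewrite -opprB sinN mulrN oppr_lt0 mulr_gt0.
by split; [exact: ltW | split=> // E0; rewrite E0 ltxx in neg].
Qed.

Lemma last_ray_extreme i (w : R[i]) : w != 0 -> (i < s)%N -> ray (expi (th i)) w ->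
  - complex.Im (w * expi (- th s.-1)) <= 0 /\
  (- complex.Im (w * expi (- th s.-1)) = 0 <-> i = s.-1).
Proof.
move=> w0 iS wi; have [r r0 ->] := Im_ray (th s.-1) w0 wi.
have s0 : (0 < s)%N by apply: leq_ltn_trans iS.
have [->|is1] := eqVneq i s.-1; first by rewrite subrr sin0 mulr0 oppr0.
have h1 : th s.-1 < th i by apply: thd; rewrite ltn_neqAle is1 -ltnS prednK.
have h2 : th s < th s.-1 by apply: thd; rewrite prednK.
rewrite ths in h2; have h3 : th i <= th 0%N.
  by case: i {wi iS is1 h1} => // i; exact/ltW/thd.
have sp : 0 < r * sin (th i - th s.-1).
  rewrite mulr_gt0 //; apply: sin_gt0_pi; rewrite subr_gt0 h1 /= ltrBlDr -ltrBlDl.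
  by apply: le_lt_trans h2; rewrite lerB.
split; first by rewrite oppr_le0 ltW.
by split=> [/eqP|/eqP E]; [rewrite oppr_eq0 gt_eqF | rewrite E in is1].
Qed.

End HalfTurn.

(** * The principal element and the Coxeter rotation *)

Section ComplexExponential.
Variable R : realType.

Lemma cvg_complex (u v : nat -> R) (x y : R) :
  u @ \oo --> x -> v @ \oo --> y ->
  (fun n => (u n +i* v n : R[i]^o)) @ \oo --> (x +i* y : R[i]^o).
Proof.
move=> /cvgrPdist_lt ux /cvgrPdist_lt vy; apply/cvgrPdist_lt => -[e e'].
rewrite ltcE /= => /andP[/eqP -> e0].
have e2 : 0 < e / 2%:R by rewrite divr_gt0.
near=> n.
have un : `|x - u n| < e / 2%:R by near: n; exact: ux.
have vn : `|y - v n| < e / 2%:R by near: n; exact: vy.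
rewrite normc_def /= ltcR.
have -> : e = Num.sqrt (e ^+ 2) by rewrite sqrtr_sqr gtr0_norm.
rewrite ltr_sqrt ?exprn_gt0 // -[(x - u n) ^+ 2]real_normK ?num_real //.
rewrite -[(y - v n) ^+ 2]real_normK ?num_real //.
have := normr_ge0 (x - u n); have := normr_ge0 (y - v n); nra.
Unshelve. all: by end_near.
Qed.

Lemma expi_partial_sum (t : R) n :
  \sum_(k < n) (k`!%:R)^-1 * (0 +i* t : R[i]) ^+ k =
  series (cos_coeff t) n +i* series (sin_coeff t) n.
Proof.
elim: n => [|n IH]; first by rewrite big_ord0 /series /= !big_geq.
rewrite big_ord_recr /= IH /series /= !big_nat_recr //=.
have pow : (0 +i* t : R[i]) ^+ n =
  ((~~ odd n)%:R * (-1) ^+ n./2 * t ^+ n) +i* ((odd n)%:R * (-1) ^+ n.-1./2 * t ^+ n).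
  elim: n {IH} => [|n IH].
    by apply/eqP; rewrite eq_complex /= !expr0 !mulr1 ?mul0r ?mulr0n !eqxx.
  rewrite exprS IH /GRing.mul /= -!/(GRing.mul _ _) !mul0r; congr (_ +i* _).
    rewrite sub0r negbK; case: n {IH} => [|m] /=; first by rewrite !mul0r mulr0 oppr0.
    by rewrite !exprS; ring.
  by rewrite add0r exprS; ring.
rewrite pow; have -> : (n`!%:R : R[i])^-1 = (n`!%:R^-1 : R)%:C.
  by rewrite fmorphV rmorph_nat.
simpc; congr (_ +i* _); rewrite /cos_coeff /sin_coeff /=; congr (_ + _);
  by rewrite mulrC.
Qed.

(** [is_exp] speaks only through linear forms. A nonzero difference of the two sides would be
    detected by some form, on which the series has the cosine and sine series as real and imaginary
    parts. *)
Lemma is_exp_eigenvector (g : vectType R[i]) (A B : 'End(g)) v (t : R) :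
  is_exp A B -> A v = (0 +i* t) *: v -> B v = expi t *: v.
Proof.
move=> AB Av.
have iterA k : iter k A v = (0 +i* t) ^+ k *: v.
  by elim: k => [|k IH]; rewrite ?scale1r // iterS IH linearZ /= Av scalerA exprSr.
apply/eqP; rewrite -subr_eq0; apply/eqP/(contrapT (P := _ = _)) => /eqP w0.
have [f fw] := exists_functional w0.
have cv : (fun n => (series (cos_coeff t) n +i* series (sin_coeff t) n) * f v : R[i]^o) @ \oo
    --> (expi t * f v : R[i]^o).
  apply: cvgM; last exact: cvg_cst.
  apply: cvg_complex.
    by rewrite cos.unlock; exact: is_cvg_series_cos_coeff.
  by rewrite sin.unlock; exact: is_cvg_series_sin_coeff.
have := AB f v.
rewrite (_ : (fun n => _) =
    (fun n => (series (cos_coeff t) n +i* series (sin_coeff t) n) * f v)).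
  move=> /cvg_lim H1; move/cvg_lim: cv => H2.
  have E : f (B v) = expi t * f v by rewrite -H1 // H2.
  have := fw; rewrite linearB linearZ /= E subrr => /eqP.
  by rewrite eq_sym oner_eq0.
apply/funext => n; rewrite -expi_partial_sum mulr_suml; apply: eq_bigr => k _.
by rewrite iterA linearZ /= -mulrA.
Qed.

End ComplexExponential.

Section PrincipalElement.
Variables (R : realType) (g : vectType R[i]) (b : lieBracket g).
Hypothesis hsimple : lie_simple b.
Variable H : {vspace g}.
Hypothesis hH : cartan_subalgebra b H.

Lemma exp_ad_weight (t : subvs_of H) (r : R) (A : 'End(g))
    (u : g) (a : dual H) :
  is_exp (ad b ((0 +i* r) *: vsval t)) A ->
  in_root_space b a u -> forall m : R, a t = m%:C -> A u = expi (r * m) *: u.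
Proof.
move=> hA hu m am; apply: (is_exp_eigenvector hA).
rewrite adE lieZl hu am scalerA; congr (_ *: _).
by simpc.
Qed.

(** Every weight is real at [t], so [A] acts on each weight space by a nonzero scalar and is onto.
    Injectivity is what makes [A^-1] a genuine inverse. *)
Lemma exp_ad_ker0 (alpha : seq (dual H)) (t : subvs_of H) (r : R) (A : 'End(g)) :
  simple_roots (roots b H) alpha -> (forall a, a \in alpha -> a t = 1) ->
  is_exp (ad b ((0 +i* r) *: vsval t)) A -> lker A == 0%VS.
Proof.
move=> [af aD an] at1 hA.
have real a u : in_root_space b a u -> u != 0 -> exists m : R, a t = m%:C.
  move=> hu u0; have [->|a0] := eqVneq a 0; first by exists 0; rewrite lfunE.
  have hn c : nat_comb alpha c -> exists m : R, c t = m%:C.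
    move=> [n ->]; exists (\sum_(i < size alpha) (n i)%:R).
    rewrite sum_lfunE rmorph_sum; apply: eq_bigr => i _ /=.
    by rewrite -scaler_nat scale_lfunE at1 ?mem_nth // rmorph_nat [_ *: _]mulr1.
  have Da : roots b H a by split=> //; exists u.
  have [/hn//|/hn[m mE]] := an a Da.
  by exists (- m); rewrite rmorphN /= -mE opp_lfunE opprK.
have lA : limg A = fullv.
  apply/eqP; rewrite eqEsubv subvf; apply/subvP => v _.
  have [r' [-> Hr]] := weight_decomposition hH v.
  rewrite big_seq; apply: memv_suml => p /Hr[hp p0].
  have [m mE] := real _ _ hp p0.
  have -> : p.2 = A ((expi (r * m))^-1 *: p.2).
    rewrite linearZ /= (exp_ad_weight hA hp mE) scalerA mulVf ?scale1r //.
    exact: expi_neq0.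
  by rewrite memv_img // memvf.
have := limg_ker_dim A fullv; rewrite capfv lA -[RHS]add0n => /addIn/eqP.
by rewrite dimv_eq0.
Qed.

(** The simple roots take the value 1 at [t], and [- psi] takes the value [1 - s]. After
    multiplication by [2 pi / s] these differ by a full turn, so all terms of [E] are scaled
    alike. *)
Lemma principal_grading (l : nat) (alpha : l.-tuple (dual H))
    (halpha : simple_roots (roots b H) alpha) (psi : dual H)
    (hpsi : highest_root (roots b H) alpha psi) (q : 'I_l -> nat)
    (hq : psi = \sum_(i < l) tnth alpha i *+ q i) (s : nat)
    (hs : s = (1 + \sum_(i < l) q i)%N)
    (e : dual H -> g)
    (he : forall a, roots b H a -> e a != 0 /\ in_root_space b a (e a))
    (eps : 'I_l -> subvs_of H)
    (heps : forall i j : 'I_l, tnth alpha i (eps j) = (i == j)%:R)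
    (A : 'End(g))
    (hA : is_exp (ad b ((0 +i* (2%:R * pi / s%:R)) *: vsval (\sum_(i < l) eps i))) A)
    (c : 'I_l.+1 -> R[i]) (E : g)
    (hE : E = c ord0 *: e (- psi) + \sum_(i < l) c (lift ord0 i) *: e (tnth alpha i)) :
  (A^-1)%VF E = expi (- (2%:R * pi / s%:R)) *: E.
Proof.
have [af aD an] := halpha.
set t := \sum_(i < l) eps i in hA.
have s0 : (s%:R : R) != 0 by rewrite hs pnatr_eq0.
have at1 i : tnth alpha i t = 1.
  rewrite linear_sum (bigD1 i) //= heps eqxx big1 ?addr0 // => j ji.
  by rewrite heps eq_sym (negPf ji).
have k0 : lker A == 0%VS.
  by apply: (exp_ad_ker0 halpha _ hA) => a /tnthP[i ->].
have AE : A E = expi (2%:R * pi / s%:R) *: E.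
  rewrite hE linearD /= linearZ /= linear_sum scalerDr scaler_sumr; congr (_ + _).
    rewrite scalerA mulrC -scalerA; congr (_ *: _).
    have hm : (- psi) t = (1 - s%:R)%:C.
      rewrite opp_lfunE hq sum_lfunE hs natrD opprD addrA subrr add0r rmorphN.
      rewrite natr_sum rmorph_sum; congr (- _); apply: eq_bigr => i _.
      by rewrite -scaler_nat scale_lfunE at1 /= rmorph_nat [_ *: _]mulr1.
    have [_ hr] := he _ (roots_opp hsimple hH hpsi.1).
    rewrite (exp_ad_weight hA hr hm); congr (_ *: _).
    rewrite -[RHS](expi_sub2pi _ 1) mulr1; congr expi.
    by rewrite mulrBr mulr1 divfK.
  apply: eq_bigr => i _; rewrite linearZ /= scalerA mulrC -scalerA; congr (_ *: _).
  have [_ hr] := he _ (aD _ (mem_tnth i alpha)).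
  by rewrite (exp_ad_weight hA hr (m := 1)) ?mulr1 // at1.
rewrite -[E in LHS](_ : A (expi (- (2%:R * pi / s%:R)) *: E) = E).
  by rewrite lker0_lfunK.
by rewrite linearZ /= AE scalerA mulrC expiNM scale1r.
Qed.

End PrincipalElement.

(** * Roots on rays permuted by the Coxeter element *)

Section CoxeterRays.
Variables (R : realType) (g : vectType R[i]) (b : lieBracket g).
Hypothesis hsimple : lie_simple b.
Variable H : {vspace g}.
Hypothesis hH : cartan_subalgebra b H.
Variables P1 P2 : seq (dual H).
Local Notation D := (roots b H).
Local Notation S := (P1 ++ P2).
Hypothesis hP : simple_roots D S.
Hypotheses (horth1 : mutually_orthogonal b P1) (horth2 : mutually_orthogonal b P2).
Local Notation t1 := (prod_reflections b P1).
Local Notation t2 := (prod_reflections b P2).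
Variables (s : nat) (z : dual H -> R[i]) (th : nat -> R).
Hypothesis s3 : (2 < s)%N.
Hypothesis zD : {morph z : u v / u + v}.
Hypothesis zN : forall a, z (- a) = - z a.
Hypothesis z0 : forall a, D a -> z a != 0.
Hypothesis zg : forall a, z (t2 (t1 a)) = z a * expi (- (2%:R * pi / s%:R)).
(** Rays are numbered from 0 here: [on i] stands for the singular direction with label [i + 1],
    continued with period [2 * s]. *)
Local Notation on i a := (ray (expi (th i)) (z a)).
Hypothesis thd : forall i j, (i < j)%N -> th j < th i.
Hypothesis thN : forall i, th (i + 2 * s)%N = th i - 2%:R * pi.
Hypothesis th_root : forall i, exists2 a, D a & on i a.
Hypothesis root_th : forall a, D a -> exists2 i, (i < 2 * s)%N & on i a.
Hypothesis hpos : forall a, D a -> nat_comb S a <-> exists2 i, (i < s)%N & on i a.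
Implicit Types a : dual H.

Let N0 : (0 < 2 * s)%N. Proof. by rewrite muln_gt0 /= (ltn_trans _ s3). Qed.
Let Su : uniq S. Proof. by case: hP => /free_uniq. Qed.
Let PD1 a : a \in P1 -> D a.
Proof. by move=> aP; have [_ + _] := hP; apply; rewrite mem_cat aP. Qed.
Let PD2 a : a \in P2 -> D a.
Proof. by move=> aP; have [_ + _] := hP; apply; rewrite mem_cat aP orbT. Qed.
Let P1u : uniq P1. Proof. by move: Su; rewrite cat_uniq => /and3P[]. Qed.
Let P2u : uniq P2. Proof. by move: Su; rewrite cat_uniq => /and3P[]. Qed.
Let P12 a : a \in P1 -> a \notin P2.
Proof.
move=> aP; move: Su; rewrite cat_uniq => /and3P[_ /hasPn dis _].
by apply/negP => /dis; rewrite /= aP.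
Qed.
Let t1K : involutive t1. Proof. exact: (prod_reflections_involutive hsimple hH PD1). Qed.
Let t2K : involutive t2. Proof. exact: (prod_reflections_involutive hsimple hH PD2). Qed.
Let t1D a : D a -> D (t1 a). Proof. exact: prod_reflections_roots. Qed.
Let t2D a : D a -> D (t2 a). Proof. exact: prod_reflections_roots. Qed.
Let gD a : D a -> D (t2 (t1 a)). Proof. by move=> Da; exact/t2D/t1D. Qed.
Let ND a : D a -> D (- a). Proof. exact: roots_opp. Qed.
Let t1N a : a \in P1 -> t1 a = - a. Proof. exact: prod_reflections_simple. Qed.
Let t2N a : a \in P2 -> t2 a = - a. Proof. exact: prod_reflections_simple. Qed.

Lemma on_unique a i j : D a -> (i < 2 * s)%N -> (j < 2 * s)%N -> on i a -> on j a -> i = j.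
Proof.
move=> Da iN jN ai aj; have := angle_unique z0 N0 thd thN Da ai aj.
by rewrite !modn_small.
Qed.

Lemma on_mod a i j : D a -> (j < 2 * s)%N -> i = (j + 2 * s)%N -> on i a -> on j a.
Proof.
move=> Da jN -> /(root_angle_mod z0 N0 thd thN root_th Da).
by rewrite modnDr modn_small.
Qed.

Lemma on_gamma a i : D a -> on i a -> on (i + 2)%N (t2 (t1 a)).
Proof.
have [|m [+ _ sh]] := angle_shift z0 N0 thd thN th_root root_th
  (ltn_trans (ltn0Sn 1) s3) _ gD (fun a _ => zg a).
  by rewrite mulrC divfK // pnatr_eq0 -lt0n (ltn_trans _ s3).
rewrite mulnC => /eqP; rewrite eqn_pmul2r ?(ltn_trans _ s3) // => /eqP m2.
by rewrite -m2; exact: sh.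
Qed.

Let half_turn :
  (forall i, th (i + s)%N = th i - pi) /\ (forall a i, D a -> on i a -> on (i + s)%N (- a)).
Proof.
have zNpi a : D a -> z (- a) = z a * expi (- pi).
  move=> _; rewrite zN (_ : expi (- pi) = -1) ?mulrN1 //.
  by apply: oppr_inj; rewrite opprK -mulN1r -[X in X * _]expi_pi expiNM.
have [m [+ thS sh]] := angle_shift z0 N0 thd thN th_root root_th (ltn0Sn 1) erefl ND zNpi.
by move/eqP; rewrite eqn_pmul2l // => /eqP ms; rewrite -ms.
Qed.

Let thS : th s = th 0%N - pi.
Proof. by have [h _] := half_turn; rewrite -h. Qed.

Let on_opp a i : D a -> on i a -> on (i + s)%N (- a).
Proof. by have [_ h] := half_turn; exact: h. Qed.

Lemma on_negative a i : D a -> on i a -> (s <= i < 2 * s)%N -> ~ nat_comb S a.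
Proof.
move=> Da ai /andP[si iN] /(hpos Da)[j js aj].
have jN : (j < 2 * s)%N by clear -js; lia.
have ij := on_unique Da iN jN ai aj; clear -ij js si; lia.
Qed.

Lemma on_gamma_inv a i : D a -> (i < 2 * s)%N -> on i (t2 (t1 a)) ->
  exists2 j, (j < 2 * s)%N & on j a /\ (j + 2 = i \/ j + 2 = i + 2 * s)%N.
Proof.
move=> Da iN gi; have [j jN aj] := root_th Da; exists j => //; split=> //.
have E := angle_unique z0 N0 thd thN (gD Da) (on_gamma Da aj) gi.
by apply: modn_cases => //; clear -jN s3; lia.
Qed.

(** It would make a rotation by [2 pi / s] equal to a half turn, although [s > 2]. *)
Lemma gamma_neq_opp a : D a -> t2 (t1 a) <> - a.
Proof.
move=> Da ga; have := zg a; rewrite ga zN => /eqP.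
rewrite -mulrN1 -expi_pi => /eqP /(mulfI (z0 Da)) E1.
have pi0 := pi_gt0 R; have s0 : (0 : R) < s%:R by rewrite ltr0n (ltn_trans _ s3).
have c0 : 0 < 2%:R * pi / s%:R :> R by rewrite divr_gt0 ?mulr_gt0.
have cpi : 2%:R * pi / s%:R < pi :> R.
  by rewrite ltr_pdivrMr // mulrC ltr_pM2l // ltr_nat.
have := expi_inj E1.
by rewrite opprK gtr0_norm => [/(_ _)|]; lra.
Qed.

Let simple_pos a : a \in S -> nat_comb S a.
Proof.
move=> aS; apply/(nat_combP _ Su); exists (fun y => (y == a) : nat).
rewrite (bigD1_seq a) //= eqxx mulr1n big1 ?addr0 // => y /negPf ->.
exact: mulr0n.
Qed.

Let simple_opp_not_pos a : a \in S -> ~ nat_comb S (- a).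
Proof.
move=> aS aN; have [Sf SD _] := hP; have [/eqP + _] := SD a aS; apply.
exact: nat_comb_opp Sf (simple_pos aS) aN.
Qed.

(** [extreme_roots_simple] is applied to the inverse [t1 t2] of the Coxeter element, which carries
    ray 0 to ray [2s - 2], a negative one since [s > 2]. *)
Lemma first_ray_simple a : D a -> on 0%N a -> a \in P2.
Proof.
move=> Da a0; have := @extreme_roots_simple _ _ _ hsimple _ hH _ _ hP horth1 horth2 R
  (fun a => complex.Im (z a * expi (- th 0%N))) [set a | D a /\ on 0%N a].
apply=> // [u v|c Dc|c [Dc c0]].
- by rewrite zD mulrDl raddfD.
- move=> /(hpos Dc)[i iS ci].
  have [h1 h2] := first_ray_extreme thd thS (z0 Dc) iS ci; split=> //.
  apply: (iff_trans h2); split=> [E|[_ c0]]; first by rewrite E in ci.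
  by apply: (on_unique Dc) ci c0 => //; clear -iS; lia.
- have De := t1D (t2D Dc); have ge : t2 (t1 (t1 (t2 c))) = c by rewrite t1K t2K.
  split=> //; first by apply/(hpos Dc); exists 0%N => //; rewrite (ltn_trans _ s3).
    have [//||j jN [ej jE]] := on_gamma_inv (i := 0) De; first by rewrite ge.
    by apply: (on_negative De ej); rewrite jN andbT; clear -jE jN s3; lia.
  move=> E; move: ge; rewrite E => ge.
  by apply: (gamma_neq_opp (ND Dc)); rewrite opprK.
Qed.

(** The mirror argument exchanges [P1] and [P2] and uses [t2 t1] itself, which carries ray [s - 1]
    to the negative ray [s + 1]. *)
Lemma last_ray_simple a : D a -> on s.-1 a -> a \in P1.
Proof.
have hP' : simple_roots D (P2 ++ P1) by apply: simple_roots_perm hP; rewrite perm_catC.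
have posC c : nat_comb (P2 ++ P1) c <-> nat_comb S c.
  by split; apply: nat_comb_perm; rewrite ?(uniq_catC P2) // perm_catC.
have sN : (s.-1 < 2 * s)%N by clear -s3; lia.
move=> Da as1; have := @extreme_roots_simple _ _ _ hsimple _ hH _ _ hP' horth2 horth1 R
  (fun a => - complex.Im (z a * expi (- th s.-1))) [set a | D a /\ on s.-1 a].
apply=> // [u v|c Dc|c [Dc cs]].
- by rewrite zD mulrDl raddfD opprD.
- move=> /posC/(hpos Dc)[i iS ci].
  have [h1 h2] := last_ray_extreme thd thS (z0 Dc) iS ci; split=> //.
  apply: (iff_trans h2); split=> [E|[_ cs]]; first by rewrite E in ci.
  by apply: (on_unique Dc) ci cs => //; clear -iS; lia.
- split=> //; last exact: gamma_neq_opp.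
    by apply/posC/(hpos Dc); exists s.-1 => //; clear -s3; lia.
  move=> /posC; apply: (on_negative (gD Dc) (on_gamma Dc cs)).
  by clear -s3; lia.
Qed.

(** The Coxeter element sends the positive root [t1 a] to [- a], so [t1 a] lies on ray [s - 2] or
    [s - 1]. In the second case [t1 a] would be in [P1] and [a] its negative. Hence [- a] is on ray
    [s] and [a] on ray 0. *)
Lemma simple2_on_first_ray a : a \in P2 -> on 0%N a.
Proof.
move=> a2; have aS : a \in S by rewrite mem_cat a2 orbT.
have a1 : a \notin P1 by apply: contraL a2; exact: P12.
have Da := PD2 a2; have Dt := t1D Da.
have [i iS ti] : exists2 i, (i < s)%N & on i (t1 a).
  apply/(hpos Dt); apply: (prod_reflections_positive hsimple hH hP) => //.
  exact: simple_pos.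
have := on_gamma Dt ti; rewrite t1K t2N // => gi.
have is2 : (s <= i + 2)%N.
  rewrite leqNgt; apply/negP => lt; apply: (simple_opp_not_pos aS).
  by apply/(hpos (ND Da)); exists (i + 2)%N.
have [is1|is1] := eqVneq i s.-1.
  have tP : t1 a \in P1 by apply: last_ray_simple; rewrite // -is1.
  case: (@simple_opp_not_pos (t1 a)); first by rewrite mem_cat tP.
  by rewrite -t1N // t1K; exact: simple_pos.
apply: (@on_mod _ (i + 2 + s)%N) => //; first by clear -is2 is1 iS; lia.
by have := on_opp (ND Da) gi; rewrite opprK.
Qed.

(** The Coxeter element sends the negative root [- a] to the positive root [t2 a], which must then
    lie on ray 0 or 1. Ray 0 would put [t2 a] in [P2], so it is ray 1, and [- a] lies on ray
    [2s - 1]. *)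
Lemma simple1_on_last_ray a : a \in P1 -> on s.-1 a.
Proof.
move=> a1; have aS : a \in S by rewrite mem_cat a1.
have a2 := P12 a1; have Da := PD1 a1; have Dt := t2D Da.
have [i iS ti] : exists2 i, (i < s)%N & on i (t2 a).
  apply/(hpos Dt); apply: (prod_reflections_positiver hsimple hH hP) => //.
  exact: simple_pos.
have ga : t2 (t1 (- a)) = t2 a by rewrite -t1N // t1K.
rewrite -ga in ti; have [|j jN [aj jE]] := on_gamma_inv (ND Da) _ ti.
  by clear -iS; lia.
have sj : (s <= j)%N.
  rewrite leqNgt; apply/negP => lt; apply: (simple_opp_not_pos aS).
  by apply/(hpos (ND Da)); exists j.
have [i0|i0] := eqVneq i 0%N.
  have tP : t2 a \in P2 by apply: first_ray_simple; rewrite // -ga -i0.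
  case: (@simple_opp_not_pos (t2 a)); first by rewrite mem_cat tP orbT.
  by rewrite -t2N // t2K; exact: simple_pos.
apply: (@on_mod _ (j + s)%N) => //; first by clear -s3; lia.
  by clear -sj i0 jE jN s3 iS; lia.
by have := on_opp (ND Da) aj; rewrite opprK.
Qed.

Lemma first_rayE : [set a | D a /\ on 0%N a] = [set` P2].
Proof.
apply/seteqP; split=> a /= => [[]|a2]; first exact: first_ray_simple.
by split; [exact: PD2 | exact: simple2_on_first_ray].
Qed.

Lemma last_rayE : [set a | D a /\ on s.-1 a] = [set` P1].
Proof.
apply/seteqP; split=> a /= => [[]|a1]; first exact: last_ray_simple.
by split; [exact: PD1 | exact: simple1_on_last_ray].
Qed.

(** Ray 1 comes from ray [2s - 1], the opposite of the last positive ray. *)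
Lemma second_rayE :
  [set a | D a /\ on 1%N a] = (t2 \o t1) @` (-%R @` [set` P1]).
Proof.
have N1 : (1 < 2 * s)%N by clear -s3; lia.
apply/seteqP; split=> [a /= [Da a1]|_ [_ [a a1 <-] <-]].
  have De := t1D (t2D Da); have ge : t2 (t1 (t1 (t2 a))) = a by rewrite t1K t2K.
  have [//||j jN [ej jE]] := on_gamma_inv (i := 1) De; first by rewrite ge.
  exists (t1 (t2 a)) => //; exists (- t1 (t2 a)); last exact: opprK.
  apply: last_ray_simple; first exact: ND.
  apply: (@on_mod _ (j + s)%N); [exact: ND|clear -s3; lia| |exact: on_opp].
  by clear -jE jN s3; lia.
have Da := PD1 a1; split; first exact/gD/ND.
apply: (@on_mod _ (s.-1 + s + 2)%N) => //=; [exact/gD/ND|clear -s3; lia|].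
by apply: on_gamma; [exact: ND|apply: on_opp => //; exact: simple1_on_last_ray].
Qed.

(** Ray [s - 2] is carried to ray [s], the opposite of ray 0. *)
Lemma penultimate_rayE :
  [set a | D a /\ on s.-2 a] = (t2 \o t1) @^-1` (-%R @` [set` P2]).
Proof.
apply/seteqP; split=> [a /= [Da as2]|a /= [p p2 pE]].
  have Dg := gD Da; exists (- t2 (t1 a)); last exact: opprK.
  apply: first_ray_simple; first exact: ND.
  apply: (@on_mod _ (s.-2 + 2 + s)%N) => //; [exact: ND|clear -s3; lia|].
  by apply: on_opp => //; exact: on_gamma.
have Dp := PD2 p2; have Da : D a.
  by rewrite -[a]t1K -[t1 a]t2K -pE; apply/t1D/t2D/ND.
split=> //; have := on_opp Dp (simple2_on_first_ray p2); rewrite pE add0n => ps.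
have [|j jN [aj jE]] := on_gamma_inv Da _ ps; first by clear -s3; lia.
by rewrite (_ : s.-2 = j) //; clear -jE jN s3; lia.
Qed.

End CoxeterRays.

Theorem theorem5p7 (R : realType) (g : vectType R[i]) (b : lieBracket g)
  (hsimple : lie_simple b)
  (H : {vspace g}) (hH : cartan_subalgebra b H)
  (l : nat) (hl : (1 < l)%N) (hrank : \dim H = l)
  (alpha : l.-tuple (dual H)) (halpha : simple_roots (roots b H) alpha)
  (psi : dual H) (hpsi : highest_root (roots b H) alpha psi)
  (q : 'I_l -> nat) (hq : psi = \sum_(i < l) tnth alpha i *+ q i)
  (s : nat) (hs : s = (1 + \sum_(i < l) q i)%N)
  (e : dual H -> g)
  (he : forall a, roots b H a -> e a != 0 /\ in_root_space b a (e a))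
  (eps : 'I_l -> subvs_of H)
  (heps : forall i j : 'I_l, tnth alpha i (eps j) = (i == j)%:R)
  (x0 : g) (hx0 : x0 = vsval (\sum_(i < l) eps i))
  (AdP0 : 'End(g))
  (hP0 : is_exp (ad b ((0 +i* (2%:R * pi / s%:R)) *: x0)) AdP0)
  (c : 'I_l.+1 -> R[i]) (hc : forall i, c i != 0)
  (E : g)
  (hE : E = c ord0 *: e (- psi) + \sum_(i < l) c (lift ord0 i) *: e (tnth alpha i))
  (H' : {vspace g}) (hH' : cartan_subalgebra b H') (hcent : H' = centralizer b E)
  (d : nat -> set R[i])
  (hd : clockwise_labelling (singular_directions b H' E) (2 * s)%N d)
  (P1 P2 : seq (dual H')) (hP : simple_roots (roots b H') (P1 ++ P2))
  (horth1 : mutually_orthogonal b P1) (horth2 : mutually_orthogonal b P2)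
  (gamma : dual H' -> dual H')
  (hgamma : gamma = prod_reflections b P2 \o prod_reflections b P1)
  (hdelta : gamma = coadjoint AdP0)
  (hdisj : trivIset [set i | (1 <= i <= s)%N] (roots_on b H' E d))
  (hpos : positive_roots (roots b H') (P1 ++ P2) =
          \bigcup_(i in [set i | (1 <= i <= s)%N]) roots_on b H' E d i) :
  [/\ roots_on b H' E d 1 = [set` P2],
      roots_on b H' E d 2 = gamma @` (-%R @` [set` P1]),
      roots_on b H' E d s.-1 = gamma @^-1` (-%R @` [set` P2]) &
      roots_on b H' E d s = [set` P1]].
Proof.
have q1 := highest_root_coef_gt0 halpha hpsi hq.
(* Each [q i] is at least 1, so [s] is at least [l + 1]. *)
have s3 : (2 < s)%N.
  rewrite hs add1n ltnS; apply: (leq_trans hl).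
  by rewrite -[l in (l <= _)%N]card_ord -sum1_card; apply: leq_sum => i _; exact: q1.
have AE : (AdP0^-1)%VF E = expi (- (2%:R * pi / s%:R)) *: E.
  move: hP0; rewrite hx0 => hP0'.
  have gr := principal_grading hsimple hH halpha hpsi hq hs he heps hP0'.
  exact: gr c E hE.
have EH : E \in H' by rewrite hcent memv_ker adE lie_alt.
pose z (a : dual H') := dual_at a (- E).
have zD : {morph z : u v / u + v} by move=> u v; rewrite /z /dual_at add_lfunE.
have zN a : z (- a) = - z a by rewrite /z /dual_at opp_lfunE.
have zE a : z a = - a (vsproj H' E) by rewrite /z /dual_at !linearN.
have zg a : z (prod_reflections b P2 (prod_reflections b P1 a)) =
    z a * expi (- (2%:R * pi / s%:R)).
  (* By [hdelta] the product of reflections composes [a] with the inverse of [AdP0], of which [E] is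
     an eigenvector; the projection to [H'] is harmless on multiples of [E]. *)
  rewrite (_ : prod_reflections _ _ _ = coadjoint AdP0 a); last by rewrite -hdelta hgamma.
  rewrite !zE /coadjoint !comp_lfunE ![linfun _ _]lfunE /= vsprojK // AE.
  by rewrite [vsproj H' _]linearZ [a (_ *: _)]linearZ mulNr; congr (- _); exact: mulrC.
have z0 a : roots b H' a -> z a != 0.
  (* If [a] vanished at [E], its root vector would centralize [E] and so lie in [H'], where the
     weight is 0. *)
  move=> [a0 [v v0 hv]]; rewrite zE oppr_eq0; apply: contraNneq a0 => aE.
  have vH : v \in H' by rewrite hcent memv_ker adE -(vsprojK EH) hv aE scale0r.
  by apply/eqP; exact: in_root_space_unique v0 hv (cartan_weight0 hH' vH).
have s0 : (0 < s)%N by exact: ltn_trans s3.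
have N0 : (0 < 2 * s)%N by rewrite muln_gt0.
have [th [thd thN dE th_root root_th]] := labelling_angles (z := z) N0 hd.
(* This is the passage from labels starting at 1 to angles indexed from 0. *)
have onE i : (i < s)%N ->
    roots_on b H' E d i.+1 = [set a | roots b H' a /\ ray (expi (th i)) (z a)].
  by move=> iS; rewrite /roots_on dE // (leq_trans iS) // leq_pmull.
have hpos' a : roots b H' a ->
    nat_comb (P1 ++ P2) a <-> exists2 i, (i < s)%N & ray (expi (th i)) (z a).
  move=> Da; have -> : nat_comb (P1 ++ P2) a = positive_roots (roots b H') (P1 ++ P2) a.
    by apply/propext; split=> [|[]].
  rewrite hpos; split=> [[i /andP[i1 iS] ai]|[i iS ai]].
    by case: i i1 iS ai => // i _ iS; rewrite onE // => -[_ ai]; exists i.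
  by exists i.+1 => //; rewrite onE.
rewrite hgamma; split.
- by rewrite onE // (first_rayE
    hsimple hH' hP horth1 horth2 s3 zD zN z0 zg thd thN th_root root_th hpos').
- by rewrite onE ?(ltnW s3) // (second_rayE
    hsimple hH' hP horth1 horth2 s3 zD zN z0 zg thd thN th_root root_th hpos').
- have s1 : (0 < s.-1)%N by rewrite -ltnS prednK // ltnW.
  rewrite -[s.-1]prednK // onE ?(penultimate_rayE
    hsimple hH' hP horth1 horth2 s3 zD zN z0 zg thd thN th_root root_th hpos') //.
  by rewrite prednK // leq_pred.
rewrite -[X in roots_on _ _ _ _ X](prednK s0) onE ?prednK //.
exact: (last_rayE
    hsimple hH' hP horth1 horth2 s3 zD zN z0 zg thd thN th_root root_th hpos').
Qed.
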